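(* Let $U$ be the subalgebra of the $q$-shuffle algebra $(\mathbb V,\star)$ generated by $x$ and $y$. Let $\Omega$ be the set of elements $$\{W_{-i}\}_{i\in\mathbb N},\qquad \{G_{j+1}\}_{j\in\mathbb N},\qquad \{W_{k+1}\}_{k\in\mathbb N}.$$ Let $<$ be any linear order on $\Omega$ satisfying one of the following, for all $i,j,k\in\mathbb N$: (i) $W_{-i}<G_{j+1}<W_{k+1}$; (ii) $W_{k+1}<G_{j+1}<W_{-i}$; (iii) $W_{k+1}<W_{-i}<G_{j+1}$; (iv) $W_{-i}<W_{k+1}<G_{j+1}$; (v) $G_{j+1}<W_{k+1}<W_{-i}$; (vi) $G_{j+1}<W_{-i}<W_{k+1}$. Then the elements $a_1\star\cdots\star a_n$, where $n\in\mathbb N$, $a_i\in\Omega$ and $a_1\le\cdots\le a_n$, form a basis for $U$. That is, $\Omega$ with the order $<$ is a PBW basis for $U$.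
   Context: Let $\mathbb F$ be a field and let $q\in\mathbb F$ be nonzero and not a root of unity. Let $\mathbb V$ be the free associative $\mathbb F$-algebra on noncommuting generators $x,y$. The words in $x,y$, including the empty word $1$, form a basis of $\mathbb V$. Juxtaposition denotes concatenation of words. Set $\langle x,x\rangle=\langle y,y\rangle=2$ and $\langle x,y\rangle=\langle y,x\rangle=-2$. The $q$-shuffle product $\star$ on $\mathbb V$ is the bilinear product determined as follows: - $1\star v=v\star 1=v$; - for nontrivial words $u=u_1\cdots u_r$ and $v=v_1\cdots v_s$, $$u\star v=u_1\big((u_2\cdots u_r)\star v\big)+v_1\big(u\star (v_2\cdots v_s)\big)q^{\langle u_1,v_1\rangle+\cdots+\langle u_r,v_1\rangle}.$$ This makes $\mathbb V$ an associative algebra, the $q$-shuffle algebra. Alternating words: for $k\in\mathbb N$, - $W_{-k}=xyxy\cdots x$ is the alternating word of length $2k+1$ beginning and ending with $x$ (so $W_0=x$); - $W_{k+1}=yxyx\cdots y$ is the alternating word of length $2k+1$ beginning and ending with $y$ (so $W_1=y$); - $G_k=yxyx\cdots yx$ is the word of length $2k$ (so $G_1=yx$), with $G_0=1$. *)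

(* Defs.v *)
From HB Require Import structures.
From mathcomp Require Import all_boot all_order all_algebra.
Set Implicit Arguments. Unset Strict Implicit. Unset Printing Implicit Defensive.
Import Order.TTheory GRing.Theory Num.Theory.
Local Open Scope ring_scope.

Definition word := seq bool.
Definition lx : bool := false.
Definition ly : bool := true.

Definition lc (F : fieldType) := seq (F * word).

(* The element of V = F<x,y> represented by a formal combination,
   viewed as its coefficient function on the word basis. *)
Definition vec (F : fieldType) (L : lc F) : word -> F :=
  fun w => \sum_(p <- L) (if p.2 == w then p.1 else 0).

Definition bform (a b : bool) : int := if a == b then 2%:Z else - 2%:Z.

Fixpoint shw (F : fieldType) (q : F) (u v : word) {struct u} : lc F :=
  match u with
  | [::] => [:: (1, v)]
  | a :: u' =>
    let fix aux (v : word) : lc F :=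
      match v with
      | [::] => [:: (1, u)]
      | b :: v' =>
          [seq (p.1, a :: p.2) | p <- shw q u' v]
          ++ [seq (p.1 * q ^ (\sum_(c <- u) bform c b), b :: p.2) | p <- aux v']
      end
    in aux v
  end.

Definition lstar (F : fieldType) (q : F) (L M : lc F) : lc F :=
  flatten [seq [seq (a.1 * b.1 * c.1, c.2) | c <- shw q a.2 b.2] | a <- L, b <- M].

Definition lprod (F : fieldType) (q : F) (Ls : seq (lc F)) : lc F :=
  foldr (lstar q) [:: (1, [::])] Ls.

Definition alt (b : bool) (n : nat) : word := mkseq (fun i => b (+) odd i) n.
Definition Wneg (k : nat) : word := alt lx (2 * k).+1.
Definition Wpos (k : nat) : word := alt ly (2 * k).+1.
Definition Gw (k : nat) : word := alt ly (2 * k).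

(* The index set Omega:  Om_Wm i = W_{-i}, Om_G j = G_{j+1}, Om_Wp k = W_{k+1}. *)
Inductive Omega := Om_Wm of nat | Om_G of nat | Om_Wp of nat.

Definition Omega_eqb (a b : Omega) : bool :=
  match a, b with
  | Om_Wm i, Om_Wm j => i == j
  | Om_G i, Om_G j => i == j
  | Om_Wp i, Om_Wp j => i == j
  | _, _ => false
  end.

Lemma Omega_eqP : Equality.axiom Omega_eqb.
Proof.
by case=> [i|i|i] [j|j|j] /=; try (by constructor);
  apply: (iffP eqP) => [->|[]].
Qed.

HB.instance Definition _ := hasDecEq.Build Omega Omega_eqP.

Definition Omega_word (a : Omega) : word :=
  match a with
  | Om_Wm i => Wneg i
  | Om_G j => Gw j.+1
  | Om_Wp k => Wpos k
  end.

Definition omono (F : fieldType) (q : F) (s : seq Omega) : lc F :=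
  lprod q [seq [:: (1, Omega_word a)] | a <- s].

Definition gmono (F : fieldType) (q : F) (g : seq bool) : lc F :=
  lprod q [seq [:: (1, [:: b])] | b <- g].

(* U = subalgebra of (V, star) generated by x and y = linear span of all
   star-products of the generators x, y (including the empty product 1). *)
Definition inU (F : fieldType) (q : F) (f : word -> F) : Prop :=
  exists ts : seq (F * seq bool),
    f = fun w => \sum_(t <- ts) t.1 * vec (gmono q t.2) w.

Fixpoint nondecr (lt : Omega -> Omega -> Prop) (s : seq Omega) : Prop :=
  match s with
  | a :: ((b :: _) as s') => (lt a b \/ a = b) /\ nondecr lt s'
  | _ => True
  end.

Definition strict_linear_order (lt : Omega -> Omega -> Prop) : Prop :=
  [/\ forall a, ~ lt a a,
      forall a b c, lt a b -> lt b c -> lt a c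
    & forall a b, a <> b -> lt a b \/ lt b a].

Definition order_cases (lt : Omega -> Omega -> Prop) : Prop :=
     (forall i j k, lt (Om_Wm i) (Om_G j) /\ lt (Om_G j) (Om_Wp k))
  \/ (forall i j k, lt (Om_Wp k) (Om_G j) /\ lt (Om_G j) (Om_Wm i))
  \/ (forall i j k, lt (Om_Wp k) (Om_Wm i) /\ lt (Om_Wm i) (Om_G j))
  \/ (forall i j k, lt (Om_Wm i) (Om_Wp k) /\ lt (Om_Wp k) (Om_G j))
  \/ (forall i j k, lt (Om_G j) (Om_Wp k) /\ lt (Om_Wp k) (Om_Wm i))
  \/ (forall i j k, lt (Om_G j) (Om_Wm i) /\ lt (Om_Wm i) (Om_Wp k)).

(* Main.v *)
Require Import Defs.
From HB Require Import structures.
From mathcomp Require Import all_boot all_order all_algebra.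
From mathcomp Require Import zify ring boolp.
Import Order.TTheory GRing.Theory Num.Theory.
Set Implicit Arguments. Unset Strict Implicit. Unset Printing Implicit Defensive.
Local Open Scope ring_scope.

(** Write B_k = W_{-k}, C_k = W_{k+1}, D_k = G_k and let A_k be the word
    xyxy...xy of length 2k.  Removing the first letter of a word is a twisted
    derivation of the q-shuffle product which permutes the families A, B, C, D,
    so quadratic relations between alternating words are checked letter by
    letter.  These relations let one reorder B and D, D and C, while
    [B_k, C_0] is proportional to A_{k+1} - D_{k+1} and the convolution of D
    with A equals that of B with C; hence the ordered monomials B D C span a
    space stable under multiplication by x and y.

    For independence, compare a product with its deconcatenation at prefixes in
    which x exceeds y as much as possible: there B_k becomes the sum of the
    B_j (x) D_{k-j}, D_k that of the D_j (x) D_{k-j} and C_k that of the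
    D_j (x) C_{k-j}, multiplicatively.  Exchanging the roles of x and y, B_k
    becomes the sum of the A_j (x) B_{k-j} and D_{k+1} that of the
    C_j (x) B_{k-j}.  Extracting suitable components reduces a linear relation
    to relations of smaller degree.

    Word reversal is an antiautomorphism exchanging A and D, and replacing q
    by 1/q reverses products up to a power of q; together they transfer the
    orders B D C and D B C to the other four. *)

(** Deconcatenation is not multiplicative for the $q$-shuffle product: the power of $q$ depends on
    which letters fall on which side of the cut. At prefixes of extremal excess it becomes a
    constant, at the price of seeing only part of each monomial. For two families the visible part
    of a monomial in $B$ and $D$ is, with $x$ and $y$ exchanged, a shorter monomial in the opposite
    order $D$, $B$. Replacing $q$ by $1/q$ restores the order, so the induction on degree runs over
    all $q$ and both letters simultaneously. A second obstacle is $D_0=1$: different index lists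
    give the same product of even words. Zeros are therefore discarded, and where they matter they
    are recovered from the number of factors. That $q$ is no root of unity enters through
    nonvanishing constants: $1-q^{\pm2}$ and $1+q^{-2n}$, which let the alternating words be solved
    for inside $U$, and the $q$-factorial by which $x\star\cdots\star x$ differs from the word
    $x\cdots x$. *)

Lemma neq_negb (b c : bool) : b != c -> c = ~~ b.
Proof. by case: b; case: c. Qed.

Definition excess (b : bool) (w : word) : int :=
  \sum_(c <- w) (if c == b then 1 else - 1).

Definition lsign (b c : bool) : int := if c == b then 1 else - 1.

Lemma excess_nil b : excess b [::] = 0. Proof. by rewrite /excess big_nil. Qed.

Lemma excess_cons b a w : excess b (a :: w) = lsign b a + excess b w.
Proof. by rewrite /excess big_cons. Qed.

Lemma excess_cat b u v : excess b (u ++ v) = excess b u + excess b v.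
Proof. by rewrite /excess big_cat. Qed.

Lemma excess_rev b u : excess b (rev u) = excess b u.
Proof. by rewrite /excess; apply: perm_big; rewrite perm_rev. Qed.

Lemma excess_neg b u : excess (~~ b) u = - excess b u.
Proof.
rewrite /excess -sumrN; apply: eq_bigr => c _; by case: b; case: c.
Qed.

Lemma lsignC b a : lsign a b = lsign b a.
Proof. by rewrite /lsign eq_sym. Qed.

Lemma excess_lsign a b w : excess b w = lsign a b * excess a w.
Proof.
by rewrite /excess big_distrr /=; apply: eq_bigr => c _; case: a; case: b; case: c.
Qed.

(* All functions on words are allowed, not only the finitely supported ones:
   the q-shuffle product extends to them, and no support has to be tracked.
   The proof [hq0] is a parameter because associativity requires it. *)
Definition qshuffle (F : fieldType) (q : F) (hq0 : q != 0) := word -> F.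

(** * The q-shuffle algebra *)

Section Algebra.
Variables (F : fieldType) (q : F).
Hypothesis hq0 : q != 0.
Local Notation V := (qshuffle hq0).

(** The base is $q^2$ because the bilinear form takes only the values $\pm2$. *)
Definition qpow (n : int) : F := (q ^+ 2) ^ n.

Lemma qpowD m n : qpow (m + n) = qpow m * qpow n.
Proof. by rewrite /qpow expfzDr // expf_neq0. Qed.

Lemma qpow0 : qpow 0 = 1. Proof. by []. Qed.
Lemma qpow_neq0 n : qpow n != 0.
Proof. by rewrite /qpow expfz_neq0 // expf_neq0. Qed.

(* Coefficient of [w] in the product.  The first letter of [w] is the first
   letter either of the left factor, or of the right factor, which then has to
   cross the whole left factor; note that <u,a> = 2 * excess a u. *)
Fixpoint star (w : word) (f g : word -> F) : F :=
  match w with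
  | [::] => f [::] * g [::]
  | a :: w' =>
      star w' (fun u => f (a :: u)) g
      + star w' (fun u => qpow (excess a u) * f u) (fun u => g (a :: u))
  end.

Lemma starDl w f1 f2 g :
  star w (fun u => f1 u + f2 u) g = star w f1 g + star w f2 g.
Proof.
elim: w f1 f2 g => [|a w IH] f1 f2 g /=; first by rewrite mulrDl.
rewrite IH; under [X in star w X (fun u => g (a :: u))]funext => u do rewrite mulrDr.
by rewrite IH addrACA.
Qed.

Lemma starDr w f g1 g2 :
  star w f (fun u => g1 u + g2 u) = star w f g1 + star w f g2.
Proof.
elim: w f g1 g2 => [|a w IH] f g1 g2 /=; first by rewrite mulrDr.
by rewrite !IH addrACA.
Qed.

Lemma starZl w c f g : star w (fun u => c * f u) g = c * star w f g.
Proof.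
elim: w c f g => [|a w IH] c f g /=; first by rewrite mulrA.
rewrite IH; under [X in star w X (fun u => g (a :: u))]funext => u do rewrite mulrCA.
by rewrite IH mulrDr.
Qed.

Lemma starZr w c f g : star w f (fun u => c * g u) = c * star w f g.
Proof.
elim: w f g => [|a w IH] f g /=; first by rewrite mulrCA.
by rewrite !IH mulrDr.
Qed.

(** Excess adds up under shuffling, so weighting words by a power of it is an algebra
    endomorphism. *)
Lemma star_twist w (c : bool) f g :
  star w (fun u => qpow (excess c u) * f u) (fun u => qpow (excess c u) * g u)
  = qpow (excess c w) * star w f g.
Proof.
elim: w f g => [|a w IH] f g /=.
  by rewrite excess_nil qpow0 !mul1r.
rewrite excess_cons qpowD mulrDr -!mulrA -!IH.
congr (_ + _).
  under [X in star w X _]funext => u do rewrite excess_cons qpowD -mulrA.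
  by rewrite starZl.
under [X in star w _ X]funext => u do rewrite excess_cons qpowD -mulrA.
rewrite starZr; congr (_ * _).
by congr star; apply/funext => u; rewrite mulrCA.
Qed.

(** A first letter coming from [h] crosses [f] and [g] together or one after the other; [star_twist]
    identifies the two. *)
Lemma starA w f g h :
  star w f (fun u => star u g h) = star w (fun u => star u f g) h.
Proof.
elim: w f g h => [|a w IH] f g h /=; first by rewrite mulrA.
rewrite starDl -IH -addrA; congr (_ + _).
rewrite starDr !IH; congr (_ + _).
by congr star; apply/funext => u; rewrite -star_twist.
Qed.

Definition one (w : word) : F := (w == [::])%:R.

Lemma star1f w f : star w one f = f w.
Proof.
elim: w f => [|a w IH] f /=; first by rewrite /one eqxx mul1r.
have -> : (fun u => one (a :: u)) = (fun u => 0 * one u).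
  by apply/funext => u; rewrite mul0r.
rewrite starZl mul0r add0r -[RHS](IH (fun u => f (a :: u))).
congr star; apply/funext => u; rewrite /one.
by case: eqP => [->|_]; rewrite ?mulr0 // excess_nil mul1r.
Qed.

Lemma starf1 w f : star w f one = f w.
Proof.
elim: w f => [|a w IH] f /=; first by rewrite /one eqxx mulr1.
have -> : (fun u => one (a :: u)) = (fun u => 0 * one u).
  by apply/funext => u; rewrite mul0r.
by rewrite starZr mul0r addr0 IH.
Qed.

HB.instance Definition _ := gen_eqMixin V.
HB.instance Definition _ := gen_choiceMixin V.

Let Vadd (f g : V) : V := fun w => f w + g w.
Let Vopp (f : V) : V := fun w => - f w.
Let V0 : V := fun=> 0.
Let Vmul (f g : V) : V := fun w => star w f g.
Let V1 : V := one.

Lemma VaddA : associative Vadd.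
Proof. by move=> f g h; apply/funext => w; rewrite /Vadd addrA. Qed.
Lemma VaddC : commutative Vadd.
Proof. by move=> f g; apply/funext => w; rewrite /Vadd addrC. Qed.
Lemma Vadd0 : left_id V0 Vadd.
Proof. by move=> f; apply/funext => w; rewrite /Vadd add0r. Qed.
Lemma VaddN : left_inverse V0 Vopp Vadd.
Proof. by move=> f; apply/funext => w; rewrite /Vadd addNr. Qed.
HB.instance Definition _ := GRing.isZmodule.Build V VaddA VaddC Vadd0 VaddN.

Lemma VmulA : associative Vmul.
Proof. by move=> f g h; apply/funext => w; rewrite /Vmul starA. Qed.
Lemma Vmul1 : left_id V1 Vmul.
Proof. by move=> f; apply/funext => w; rewrite /Vmul star1f. Qed.
Lemma Vmulr1 : right_id V1 Vmul.
Proof. by move=> f; apply/funext => w; rewrite /Vmul starf1. Qed.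
Lemma VmulDl : left_distributive Vmul +%R.
Proof. by move=> f g h; apply/funext => w; rewrite /Vmul starDl. Qed.
Lemma VmulDr : right_distributive Vmul +%R.
Proof. by move=> f g h; apply/funext => w; rewrite /Vmul starDr. Qed.
Lemma V1neq0 : V1 != 0.
Proof.
apply/eqP => /(congr1 (fun f : V => f [::])) /eqP.
by rewrite /V1 /one eqxx oner_eq0.
Qed.
HB.instance Definition _ :=
  GRing.Zmodule_isNzRing.Build V VmulA Vmul1 Vmulr1 VmulDl VmulDr V1neq0.

Let Vscale (c : F) (f : V) : V := fun w => c * f w.
Lemma VscaleA a b f : Vscale a (Vscale b f) = Vscale (a * b) f.
Proof. by apply/funext => w; rewrite /Vscale mulrA. Qed.
Lemma Vscale1 : left_id 1 Vscale.
Proof. by move=> f; apply/funext => w; rewrite /Vscale mul1r. Qed.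
Lemma VscaleDr : right_distributive Vscale +%R.
Proof. by move=> a f g; apply/funext => w; apply: mulrDr. Qed.
Lemma VscaleDl f : {morph Vscale^~ f : a b / a + b}.
Proof. by move=> a b; apply/funext => w; apply: mulrDl. Qed.
HB.instance Definition _ :=
  GRing.Zmodule_isLmodule.Build F V VscaleA Vscale1 VscaleDr VscaleDl.
Lemma VscaleAl (a : F) (f g : V) : a *: (f * g) = a *: f * g.
Proof. by apply/funext => w; exact: (esym (starZl w a f g)). Qed.
HB.instance Definition _ := GRing.Lmodule_isLalgebra.Build F V VscaleAl.
Lemma VscaleAr (a : F) (f g : V) : a *: (f * g) = f * (a *: g).
Proof. by apply/funext => w; exact: (esym (starZr w a f g)). Qed.
HB.instance Definition _ := GRing.Lalgebra_isAlgebra.Build F V VscaleAr.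

Lemma addE (f g : V) w : (f + g) w = f w + g w. Proof. by []. Qed.
Lemma oppE (f : V) w : (- f) w = - f w. Proof. by []. Qed.
Lemma scaleE c (f : V) w : (c *: f) w = c * f w. Proof. by []. Qed.
Lemma zeroE w : (0 : V) w = 0. Proof. by []. Qed.
Lemma oneE w : (1 : V) w = (w == [::])%:R. Proof. by []. Qed.
Lemma sumE I (r : seq I) P (f : I -> V) w :
  (\sum_(i <- r | P i) f i) w = \sum_(i <- r | P i) f i w.
Proof. by elim/big_rec2: _ => // i y1 y2 _ <-. Qed.

Definition der (a : bool) (f : V) : V := fun w => f (a :: w).
Definition tw (a : bool) (f : V) : V := fun w => qpow (excess a w) * f w.

Lemma mul_cons (f g : V) a w :
  (f * g) (a :: w) = (der a f * g) w + (tw a f * der a g) w.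
Proof. by []. Qed.

Lemma mul_nil (f g : V) : (f * g) [::] = f [::] * g [::].
Proof. by []. Qed.

(** The recursion defining [star] is itself this twisted Leibniz rule. *)
Lemma derM a (f g : V) : der a (f * g) = der a f * g + tw a f * der a g.
Proof. by []. Qed.

Lemma derB a (f g : V) : der a (f - g) = der a f - der a g. Proof. by []. Qed.
Lemma derD a (f g : V) : der a (f + g) = der a f + der a g. Proof. by []. Qed.
Lemma derZ a c (f : V) : der a (c *: f) = c *: der a f. Proof. by []. Qed.
Lemma der1 a : der a 1 = 0 :> V. Proof. by []. Qed.

Lemma der_ext (f g : V) :
  f [::] = g [::] -> (forall a, der a f = der a g) -> f = g.
Proof. by move=> h H; apply/funext => -[|a w] //; apply: (congr1 (fun h => h w) (H a)). Qed.

End Algebra.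

(** * Relations between alternating words *)

Lemma alt_cons b n : alt b n.+1 = b :: alt (~~ b) n.
Proof.
rewrite /alt /mkseq /= addbF; congr (_ :: _).
rewrite -[1%N]/(1 + 0)%N iotaDl -map_comp; apply: eq_map => i /=.
by rewrite addbN addNb.
Qed.

Lemma size_alt b n : size (alt b n) = n.
Proof. by rewrite size_mkseq. Qed.

Lemma alt_cat b m n : alt b (m + n) = alt b m ++ alt (b (+) odd m) n.
Proof.
elim: m b => [|m IH] b; first by rewrite addbF.
by rewrite addSn !alt_cons IH cat_cons /= addNb addbN.
Qed.

Lemma rev_alt b n : rev (alt b n) = alt (b (+) ~~ odd n) n.
Proof.
elim: n b => [//|n IH] b.
rewrite alt_cons rev_cons IH -cats1 -[in RHS]addn1 alt_cat addn1.
by congr cat; case: b; rewrite /alt /=; case: (odd n).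
Qed.

Lemma excess_alt b n : excess b (alt b n) = (odd n)%:Z.
Proof.
elim: n b => [|n IH] b; first exact: excess_nil.
rewrite alt_cons excess_cons -[b in excess b _]negbK excess_neg IH /lsign eqxx /=.
by case: (odd n).
Qed.

(** Lets [ring] close a goal from one known equation; [k] is the multiple of that equation to be
    subtracted. *)
Lemma eq_comb (R : comPzRingType) (k a b c d : R) :
  a = b -> c - d = k * (a - b) -> c = d.
Proof. by move=> ->; rewrite subrr mulr0 => /subr0_eq. Qed.
Arguments eq_comb [R].

Section Alternating.
Variables (F : fieldType) (q : F) (hq0 : q != 0).
Local Notation V := (qshuffle hq0).
Local Notation p := (q ^+ 2).

Definition ind (u : word) : V := fun w => (w == u)%:R.

Lemma ind0 : ind [::] = 1. Proof. by []. Qed.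

Lemma der_ind a u : der a (ind u) =
  if u is c :: u' then (if a == c then ind u' else 0) else 0.
Proof.
apply/funext => w; rewrite /der /ind; case: u => [//|c u].
by rewrite eqseq_cons; case: (a == c).
Qed.

Definition homog (b : bool) (x : int) (f : V) :=
  forall w, f w != 0 -> excess b w = x.

Lemma tw_homog a b x f : homog b x f -> tw a f = qpow q (lsign b a * x) *: f.
Proof.
move=> Hf; apply/funext => w; rewrite scaleE /tw.
have [->|/Hf <-] := eqVneq (f w) 0; first by rewrite !mulr0.
by rewrite -excess_lsign.
Qed.

Lemma homog_ind b u : homog b (excess b u) (ind u).
Proof. by move=> w; rewrite /ind; case: (w =P u) => [->//|]; rewrite eqxx. Qed.

Lemma homogN b x f : homog b x f -> homog (~~ b) (- x) f.
Proof. by move=> H w /H <-; rewrite excess_neg. Qed.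

Lemma homog1 b : homog b 0 1.
Proof. by rewrite -(excess_nil b); apply: homog_ind. Qed.

Lemma homogM b x y f g : homog b x f -> homog b y g -> homog b (x + y) (f * g).
Proof.
move=> + + w; elim: w x y f g => [|a w IH] x y f g Hf Hg.
  rewrite mul_nil mulf_eq0 negb_or excess_nil => /andP[/Hf + /Hg].
  by rewrite excess_nil => <- <-.
rewrite mul_cons excess_cons => H.
have [H0|] := eqVneq ((der a f * g) w) 0; last first.
  move=> /(IH (x - lsign b a) y) -> //; first by lia.
  by move=> u /Hf; rewrite excess_cons; lia.
move: H; rewrite H0 add0r => /(IH x (y - lsign b a)) -> //; first by lia.
  move=> u; rewrite /tw mulf_eq0 negb_or => /andP[_]; exact: Hf.
by move=> u /Hg; rewrite excess_cons; lia.
Qed.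

Lemma homog_prod b I (r : seq I) (x : I -> int) (f : I -> V) :
  (forall i, homog b (x i) (f i)) ->
  homog b (\sum_(i <- r) x i) (\prod_(i <- r) f i).
Proof.
move=> H; elim: r => [|i r IH]; rewrite ?big_nil ?big_cons.
  exact: homog1.
by apply: homogM.
Qed.

Definition altw (b : bool) (n : nat) : V := ind (alt b n).
(* With x = false and y = true: [oddalt x k] = W_{-k}, [oddalt y k] = W_{k+1},
   [evenalt y k] = G_k, and [evenalt x k] is the word xyxy...xy. *)
Definition oddalt b k := altw b (2 * k).+1.
Definition evenalt b k := altw b (2 * k).
Local Notation O := oddalt.
Local Notation E := evenalt.

Lemma E0 b : E b 0 = 1. Proof. by []. Qed.

Lemma der_altw a b n : der a (altw b n) =
  if n is n'.+1 then (if a == b then altw (~~ b) n' else 0) else 0.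
Proof. by rewrite /altw; case: n => [|n]; rewrite der_ind // alt_cons. Qed.

Lemma der_O b k : der b (O b k) = E (~~ b) k.
Proof. by rewrite /O der_altw eqxx. Qed.
Lemma der_On b k : der (~~ b) (O b k) = 0.
Proof. by rewrite /O der_altw; case: b. Qed.
Lemma der_On' b k : der b (O (~~ b) k) = 0.
Proof. by rewrite /O der_altw; case: b. Qed.
Lemma der_On2 b k : der (~~ b) (O (~~ b) k) = E b k.
Proof. by rewrite der_O negbK. Qed.
Lemma der_E b k : der (~~ b) (E b k) = 0.
Proof. by rewrite /E der_altw; case: (2 * k)%N => //; case: b. Qed.
Lemma der_ES b k : der b (E b k.+1) = O (~~ b) k.
Proof. by rewrite /E der_altw mulnS /= eqxx. Qed.
Lemma der_En b k : der b (E (~~ b) k) = 0.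
Proof. by rewrite -{1}[b]negbK der_E. Qed.
Lemma der_EnS b k : der (~~ b) (E (~~ b) k.+1) = O b k.
Proof. by rewrite der_ES negbK. Qed.

Lemma homog_O b k : homog b 1 (O b k).
Proof.
have -> : 1 = excess b (alt b (2 * k).+1) by rewrite excess_alt /= mul2n odd_double.
exact: homog_ind.
Qed.
Arguments homog_O : clear implicits.
Lemma homog_On b k : homog b (- 1) (O (~~ b) k).
Proof. by rewrite -{1}[b]negbK; apply/homogN/homog_O. Qed.
Arguments homog_On : clear implicits.
Lemma homog_E b c k : homog b 0 (E c k).
Proof.
have H : homog c 0 (E c k).
  have -> : 0 = excess c (alt c (2 * k)) by rewrite excess_alt /= mul2n odd_double.
  exact: homog_ind.
move=> w Hw; rewrite (excess_lsign c) (H w Hw); exact: mulr0.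
Qed.

Arguments homog_E : clear implicits.

Lemma tw_O b k : tw b (O b k) = p *: O b k.
Proof. by rewrite (tw_homog _ (homog_O b k)) /lsign eqxx. Qed.
Lemma tw_On b k : tw (~~ b) (O b k) = p^-1 *: O b k.
Proof. by rewrite (tw_homog _ (homog_O b k)) /lsign; case: b. Qed.
Lemma tw_On' b k : tw b (O (~~ b) k) = p^-1 *: O (~~ b) k.
Proof. by rewrite -{1}[b]negbK tw_On. Qed.
Lemma tw_E a b k : tw a (E b k) = E b k.
Proof. by rewrite (tw_homog _ (homog_E a b k)) mulr0 scale1r. Qed.

Lemma tw1 a : tw a (1 : V) = 1.
Proof. exact: (tw_E a a 0). Qed.

Lemma p_neq0 : p != 0. Proof. by rewrite expf_neq0. Qed.

Definition derE := (der_O, der_On, der_On', der_On2, der_ES, der_EnS, der_E,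
  der_En, tw_O, tw_On, tw_On', tw_E, negbK).
Definition ptE := (addE, oppE, scaleE, zeroE).

Lemma altw_nil b n : altw b n.+1 [::] = 0.
Proof. by rewrite /altw /ind alt_cons. Qed.
Lemma O_nil b k : O b k [::] = 0. Proof. exact: altw_nil. Qed.

Lemma E_nil b k : E b k.+1 [::] = 0.
Proof. by rewrite /E mulnS altw_nil. Qed.

Lemma word_cons_ind (P : word -> Prop) b :
  P [::] -> (forall w, P w -> P (b :: w)) ->
  (forall w, P w -> P (~~ b :: w)) -> forall w, P w.
Proof.
move=> H0 H1 H2; elim=> // a w IH.
by have [<-|/neq_negb ->] := eqVneq b a; [apply: H1 | apply: H2].
Qed.

(* The first letter derivations permute these four families of relations, so
   a single induction on the word proves all of them at once. *)
Lemma exchange b :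
  [/\ forall k l, O b k * O b l = O b l * O b k,
      forall k l, E (~~ b) k * O b l - p *: (O b l * E (~~ b) k)
                = E (~~ b) l * O b k - p *: (O b k * E (~~ b) l),
      forall k l, E (~~ b) k * E (~~ b) l = E (~~ b) l * E (~~ b) k
    & forall k l, O b k * E (~~ b) l.+1 - E (~~ b) l.+1 * O b k
                + (E (~~ b) k.+1 * O b l - O b l * E (~~ b) k.+1) = 0].
Proof.
suff H : forall w,
  [/\ forall k l, (O b k * O b l) w = (O b l * O b k) w,
      forall k l, (E (~~ b) k * O b l - p *: (O b l * E (~~ b) k)) w
                = (E (~~ b) l * O b k - p *: (O b k * E (~~ b) l)) w,
      forall k l, (E (~~ b) k * E (~~ b) l) w = (E (~~ b) l * E (~~ b) k) w
    & forall k l, (O b k * E (~~ b) l.+1 - E (~~ b) l.+1 * O b k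
                + (E (~~ b) k.+1 * O b l - O b l * E (~~ b) k.+1)) w = 0].
  by split=> k l; apply/funext => w; case: (H w).
have pp := p_neq0.
apply: (@word_cons_ind _ b) => [|w [H1 H2 H3 H4]|w [H1 H2 H3 H4]].
- split=> k l; rewrite ?ptE !mul_nil ?O_nil ?mulr0 ?mul0r ?mulr0 //.
  + by rewrite mulrC.
  + by rewrite !subr0 addr0.
- split=> k l; rewrite ?ptE !mul_cons !derE ?mul0r ?mulr0 -?scalerAl -?scalerAr ?ptE.
  + by have := H2 k l; rewrite ?ptE => H; apply: (@eq_comb F 1 _ _ _ _ H); ring.
  + by rewrite (H3 k); ring.
  + by [].
  + by rewrite (H3 k) (H3 l); ring.
- split=> k l; rewrite ?ptE !mul_cons.
  + by rewrite !derE !mul0r !mulr0.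
  + rewrite !derE !mulr0 !mul0r ?ptE -?scalerAl ?ptE.
    case: k l => [|k] [|l]; rewrite ?E0 ?der1 ?derE ?mulr0 ?mul0r ?ptE.
    * by ring.
    * by rewrite (H1 l); field.
    * by rewrite (H1 k); field.
    * by rewrite (H1 k) (H1 l); field.
  + case: k l => [|k] [|l] //; rewrite ?E0 ?mul1r ?mulr1 ?der1 ?derE ?mulr0 ?mul0r ?ptE //.
    * by rewrite tw1 mul1r addrC.
    * by rewrite tw1 mul1r addrC.
    * by have := H4 k l; rewrite ?ptE => H; apply: (@eq_comb F 1 _ _ _ _ H); ring.
  + rewrite !derE ?mulr0 ?mul0r ?ptE -?scalerAl ?ptE.
    by rewrite (H1 k); ring.
Qed.

Lemma O_comm b k l : O b k * O b l = O b l * O b k.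
Proof. by case: (exchange b). Qed.
Lemma E_comm b k l : E b k * E b l = E b l * E b k.
Proof. by case: (exchange (~~ b)) => _ _ + _; rewrite negbK. Qed.

Definition rv (f : V) : V := fun w => f (rev w).
Definition rder (a : bool) (f : V) : V := fun w => f (rcons w a).

(** The mirror image of the defining recursion: the last letter comes from the right factor, or from
    the left one and then crosses all of [g]. When one letter is taken off each end, their mutual
    crossing contributes the same power whichever is removed first. *)
Lemma mul_rcons (f g : V) a w :
  (f * g) (rcons w a) = (f * rder a g) w + (rder a f * tw a g) w.
Proof.
elim: w f g => [|c w IH] f g.
  by rewrite /= mul_cons !mul_nil addrC /der /rder /tw !excess_nil !mul1r.
rewrite rcons_cons !mul_cons !IH.
suff -> : (rder a (tw c f) * tw a (der c g)) w = (tw c (rder a f) * der c (tw a g)) w.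
  by rewrite addrACA.
have -> : rder a (tw c f) = qpow q (lsign a c) *: tw c (rder a f).
  apply/funext => u; rewrite scaleE /rder /tw -cats1 excess_cat mulrA; congr (_ * _).
  by rewrite excess_cons excess_nil addr0 -qpowD // addrC lsignC.
have -> : der c (tw a g) = qpow q (lsign a c) *: tw a (der c g).
  by apply/funext => u; rewrite scaleE /der /tw excess_cons mulrA -qpowD.
by rewrite -scalerAl -scalerAr.
Qed.

Lemma rvK f : rv (rv f) = f.
Proof. by apply/funext => w; rewrite /rv revK. Qed.

Lemma rvM f g : rv (f * g) = rv g * rv f.
Proof.
apply/funext => w; elim: w f g => [|a w IH] f g.
  by rewrite /rv mul_nil mulrC -mul_nil.
rewrite {1}/rv rev_cons mul_rcons mul_cons.
have tww h : rv (tw a h) = tw a (rv h).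
  by apply/funext => u; rewrite /rv /tw excess_rev.
have dr h : rv (rder a h) = der a (rv h).
  by apply/funext => u; rewrite /rv /rder /der rev_cons.
by rewrite -tww -!dr -!IH.
Qed.

Lemma rvD f g : rv (f + g) = rv f + rv g. Proof. by []. Qed.
Lemma rvN f : rv (- f) = - rv f. Proof. by []. Qed.
Lemma rvZ c f : rv (c *: f) = c *: rv f. Proof. by []. Qed.
Lemma rv0 : rv 0 = 0. Proof. by []. Qed.

Lemma rv_altw b n : rv (altw b n) = altw (b (+) ~~ odd n) n.
Proof.
apply/funext => w; rewrite /rv /altw /ind -rev_alt.
by rewrite -(inj_eq (can_inj (@revK _))) revK.
Qed.
Lemma rv_O b k : rv (O b k) = O b k.
Proof. by rewrite /O rv_altw /= mul2n odd_double addbF. Qed.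
Lemma rv_E b k : rv (E b k) = E (~~ b) k.
Proof. by rewrite /E rv_altw mul2n odd_double addbT. Qed.
Lemma rv1 : rv 1 = 1. Proof. exact: (rv_E true 0). Qed.

Lemma rv_prod I (r : seq I) (f : I -> V) :
  rv (\prod_(i <- r) f i) = \prod_(i <- rev r) rv (f i).
Proof.
elim: r => [|i r IH]; first by rewrite !big_nil rv1.
by rewrite big_cons rvM IH rev_cons -cats1 big_cat big_seq1.
Qed.

(** The reversal of [exchange]: odd words are fixed, the two even families trade places, and
    reversing the products turns $p$ into $p^{-1}$ after division by $-p$. *)
Lemma exchange_r b :
  (forall k l, E b k * O b l - p^-1 *: (O b l * E b k)
                = E b l * O b k - p^-1 *: (O b k * E b l))
  /\ (forall k l, O b k * E b l.+1 - E b l.+1 * O b k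
                + (E b k.+1 * O b l - O b l * E b k.+1) = 0).
Proof.
have [_ H2 _ H4] := exchange b; split=> k l.
  have /(congr1 rv) := H2 k l.
  rewrite !(rvD, rvN, rvZ, rvM, rv_O, rv_E) negbK => H.
  have /eqP := congr1 (fun f => - p^-1 *: f) H.
  rewrite !scalerBr !scalerA !scaleNr mulNr mulVf ?p_neq0 // !scaleN1r !opprK.
  by rewrite ![- _ + _]addrC => /eqP.
have /(congr1 (fun f => - rv f)) := H4 k l.
rewrite !(rvD, rvN, rvZ, rvM, rv_O, rv_E) negbK rv0 oppr0 => <-.
by rewrite !opprD !opprK; congr (_ + _); rewrite addrC.
Qed.

Lemma exchange_l b :
  (forall k l, E (~~ b) k * O b l - p *: (O b l * E (~~ b) k)
                = E (~~ b) l * O b k - p *: (O b k * E (~~ b) l))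
  /\ (forall k l, O b k * E (~~ b) l.+1 - E (~~ b) l.+1 * O b k
                + (E (~~ b) k.+1 * O b l - O b l * E (~~ b) k.+1) = 0).
Proof. by have [_ H2 _ H4] := exchange b. Qed.

(** The right side of the exchange relation collapses at index 0 because the even word there is 1.
    This recovers an odd word from the even word of the same index and a letter. *)
Lemma E_O0 b k :
  E (~~ b) k * O b 0 - p *: (O b 0 * E (~~ b) k) = (1 - p) *: O b k.
Proof.
have [-> _] := exchange_l b.
by rewrite E0 mul1r mulr1 scalerBl scale1r.
Qed.

Lemma E_On0 b k :
  E (~~ b) k * O (~~ b) 0 - p^-1 *: (O (~~ b) 0 * E (~~ b) k)
  = (1 - p^-1) *: O (~~ b) k.
Proof.
have [-> _] := exchange_r (~~ b).
by rewrite E0 mul1r mulr1 scalerBl scale1r.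
Qed.

(** Derivation at [b] turns this into [E_On0]; derivation at the other letter removes the single
    letter and leaves multiples of [O b k]. *)
Lemma O_On0 b k : O b k * O (~~ b) 0 - O (~~ b) 0 * O b k
  = (1 - p^-1) *: (E b k.+1 - E (~~ b) k.+1).
Proof.
apply: der_ext => [|a].
  by rewrite !ptE !mul_nil !O_nil /E mulnS !altw_nil; ring.
have [<-|/neq_negb ->] := eqVneq b a.
  by rewrite derB !derM derZ derB !derE mul0r mulr0 addr0 add0r -scalerAl E_On0 subr0.
rewrite derB !derM derZ derB !derE E0 mul0r add0r mulr0 addr0 mulr1 mul1r sub0r.
by rewrite scalerN scalerBl opprB scale1r.
Qed.

(* Solved for [E b n.+1], this eliminates the words that are not in Omega. *)
Lemma E_convolution b n :
  \sum_(k < n.+2) p^-1 ^+ k *: (E (~~ b) k * E b (n.+1 - k))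
  = \sum_(k < n.+1) p^-1 ^+ k *: (O b k * O (~~ b) (n - k)).
Proof.
have der_sum a m (f : 'I_m -> V) : der a (\sum_i f i) = \sum_i der a (f i).
  by apply/funext => w; rewrite sumE /der sumE.
apply: der_ext => [|a].
  rewrite !sumE big_ord_recl !big1 ?addr0 => [|k _|k _].
  - by rewrite scaleE mul_nil subn0 E_nil !mulr0.
  - by rewrite scaleE mul_nil O_nil mul0r mulr0.
  - by rewrite scaleE mul_nil lift0 E_nil mul0r mulr0.
rewrite !der_sum; have [<-|/neq_negb ->] := eqVneq b a.
  rewrite big_ord_recr /= subnn derZ derM !derE E0 der1 !mulr0 mul0r addr0 scaler0 addr0.
  apply: eq_bigr => k _; have kn : (k <= n)%N by rewrite -ltnS.
  by rewrite subSn // !derZ !derM !derE mul0r add0r mulr0 addr0.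
rewrite big_ord_recl derZ derM !derE E0 der1 mulr0 mul0r addr0 scaler0 add0r.
apply: eq_bigr => k _; rewrite !derZ !derM lift0 subSS !derE mulr0 mul0r add0r addr0.
by rewrite -scalerAl scalerA exprSr.
Qed.
End Alternating.

(** * Spanning *)

Section Span.
Variables (F : fieldType) (A : algType F).
Implicit Types (P Q R : A -> Prop).

Definition lin_closed Q := Q 0 /\ forall (c : F) f g, Q f -> Q g -> Q (c *: f + g).
(** Impredicative: a membership is consumed by choosing [Q], so explicit combinations appear only
    where a statement asks for them. *)
Definition Span P (f : A) := forall Q, lin_closed Q -> (forall g, P g -> Q g) -> Q f.

Lemma span_gen P f : P f -> Span P f.
Proof. by move=> Pf Q _; apply. Qed.

Lemma span_lin P : lin_closed (Span P).
Proof.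
split=> [Q [] //|c f g Hf Hg Q HQ HP].
by apply: (proj2 HQ); [apply: Hf | apply: Hg].
Qed.

Lemma span0 P : Span P 0. Proof. exact: (proj1 (span_lin P)). Qed.
Lemma spanD P f g : Span P f -> Span P g -> Span P (f + g).
Proof. by rewrite -{2}[f]scale1r; apply: (proj2 (span_lin P)). Qed.
Lemma spanZ P c f : Span P f -> Span P (c *: f).
Proof. by rewrite -[c *: f]addr0 => Hf; apply: (proj2 (span_lin P)) => //; apply: span0. Qed.
Lemma spanN P f : Span P f -> Span P (- f).
Proof. by rewrite -scaleN1r; apply: spanZ. Qed.
Lemma spanB P f g : Span P f -> Span P g -> Span P (f - g).
Proof. by move=> Hf Hg; apply: spanD => //; apply: spanN. Qed.
Lemma spanZK P c f : c != 0 -> Span P (c *: f) -> Span P f.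
Proof.
by move=> c0 /(spanZ c^-1); rewrite scalerA mulVf // scale1r.
Qed.
Lemma span_sum P I (r : seq I) (T : pred I) (f : I -> A) :
  (forall i, T i -> Span P (f i)) -> Span P (\sum_(i <- r | T i) f i).
Proof. by move=> H; apply: big_ind => //; [apply: span0|move=> x y; apply: spanD]. Qed.

Lemma span_sub P Q f : (forall g, P g -> Span Q g) -> Span P f -> Span Q f.
Proof. by move=> H; apply; [apply: span_lin|]. Qed.

Lemma span_mul P Q R f g : (forall f g, P f -> Q g -> Span R (f * g)) ->
  Span P f -> Span Q g -> Span R (f * g).
Proof.
move=> H Hf Hg; apply: (Hg (fun g => Span R (f * g))).
  split=> [|c g1 g2 H1 H2]; first by rewrite mulr0; apply: span0.
  by rewrite mulrDr -scalerAr; apply: spanD => //; apply: spanZ.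
move=> {Hg}g Qg; apply: (Hf (fun f => Span R (f * g))) => [|h Ph]; last exact: H.
split=> [|c g1 g2 H1 H2]; first by rewrite mul0r; apply: span0.
by rewrite mulrDl -scalerAl; apply: spanD => //; apply: spanZ.
Qed.

Lemma span_mull P R h f : (forall f, P f -> Span R (h * f)) ->
  Span P f -> Span R (h * f).
Proof.
move=> H Hf; apply: (@span_mul (eq h) P) => //; last exact: span_gen.
by move=> _ g <-; apply: H.
Qed.
Lemma span_mulr P R h f : (forall f, P f -> Span R (f * h)) ->
  Span P f -> Span R (f * h).
Proof.
move=> H Hf; apply: (@span_mul P (eq h)) => //; last exact: span_gen.
by move=> g _ + <-; apply: H.
Qed.

Definition pr (f : nat -> A) (s : seq nat) : A := \prod_(k <- s) f k.

Lemma pr_nil f : pr f [::] = 1. Proof. exact: big_nil. Qed.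
Lemma pr_cons f k s : pr f (k :: s) = f k * pr f s. Proof. exact: big_cons. Qed.
Lemma pr_cat f s t : pr f (s ++ t) = pr f s * pr f t. Proof. exact: big_cat. Qed.
Lemma pr_rcons f s k : pr f (rcons s k) = pr f s * f k.
Proof. by rewrite -cats1 pr_cat pr_cons pr_nil mulr1. Qed.

Lemma pr_perm f s t : (forall k l, f k * f l = f l * f k) ->
  perm_eq s t -> pr f s = pr f t.
Proof.
move=> fC; have fprC k r : f k * pr f r = pr f r * f k.
  elim: r => [|l r IH]; first by rewrite pr_nil mul1r mulr1.
  by rewrite pr_cons mulrA fC -!mulrA IH.
elim: s t => [|k s IH] t; first by rewrite perm_sym => /perm_nilP ->.
move=> Hp; have kt : k \in t by rewrite -(perm_mem Hp) mem_head.
case/splitPr: kt Hp => t1 t2; rewrite -(cat1s k t2) perm_sym perm_catCA /=.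
rewrite perm_cons perm_sym => /IH E.
by rewrite pr_cons E !pr_cat ?pr_cons ?pr_nil ?mulr1 !mulrA fprC.
Qed.

Definition prod_of (P Q : A -> Prop) (h : A) := exists f g, [/\ P f, Q g & h = f * g].
Definition fam (f : nat -> A) (h : A) := exists k, h = f k.
Definition prs (f : nat -> A) (h : A) := exists s, h = pr f s.

Lemma prod_ofI P Q f g : P f -> Q g -> prod_of P Q (f * g).
Proof. by exists f, g. Qed.
Lemma famI f k : fam f (f k). Proof. by exists k. Qed.
Lemma prsI f s : prs f (pr f s). Proof. by exists s. Qed.

Section Exchange.
Variables (p : F) (be de : nat -> A).
Hypotheses (p0 : p != 0) (de0 : de 0 = 1).
Hypothesis exch2 : forall k l, de k * be l - p *: (be l * de k)
                = de l * be k - p *: (be k * de l).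
Hypothesis exch4 : forall k l, be k * de l.+1 - de l.+1 * be k
                + (de k.+1 * be l - be l * de k.+1) = 0.

(* Modulo the span of the be_i de_j, [exch4] and [exch2] give
   de_{k+1} be_l = de_{l+1} be_k = de_k be_{l+1}, so one can descend to de_0. *)
Lemma exch_db k l : Span (prod_of (fam be) (fam de)) (de k * be l).
Proof.
have G i j : Span (prod_of (fam be) (fam de)) (be i * de j).
  by apply: span_gen; apply: prod_ofI; apply: famI.
elim: k l => [|k IH] l; first by rewrite de0 mul1r -[be l]mulr1 -de0.
have -> : de k.+1 * be l = de k * be l.+1 - p *: (be l.+1 * de k)
    + p *: (be k * de l.+1) - be k * de l.+1 + be l * de k.+1.
  rewrite exch2 subrK; apply/eqP; rewrite -subr_eq -[_ - be k * _]opprB -addr_eq0.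
  by rewrite addrC exch4.
by do !(apply: spanD || apply: spanN || apply: spanZ) => //.
Qed.

(** Again a descent to [de 0]: modulo the target, [exch4] replaces [be l * de k.+1] by
    [be k * de l.+1], and [exch2] expresses $p$ times the latter through [be l.+1 * de k].
    Recovering the product itself is a division by $p$. *)
Lemma exch_bd k l : Span (prod_of (fam de) (fam be)) (be l * de k).
Proof.
have G i j : Span (prod_of (fam de) (fam be)) (de i * be j).
  by apply: span_gen; apply: prod_ofI; apply: famI.
elim: k l => [|k IH] l; first by rewrite de0 mulr1 -[be l]mul1r -de0.
suff H : Span (prod_of (fam de) (fam be)) (be k * de l.+1).
  have -> : be l * de k.+1 = be k * de l.+1 - de l.+1 * be k + de k.+1 * be l.
    by apply/eqP; rewrite eq_sym -subr_eq0 -addrA exch4.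
  by do !(apply: spanD || apply: spanN || apply: spanZ) => //.
apply: (@spanZK _ p) => //.
have -> : p *: (be k * de l.+1) = de l.+1 * be k - (de k * be l.+1 - p *: (be l.+1 * de k)).
  by rewrite exch2 opprB addrCA subrr addr0.
by do !(apply: spanD || apply: spanN || apply: spanZ) => //.
Qed.

End Exchange.

Section Swap.
Variables (f g : nat -> A).
Hypothesis swap : forall k l, Span (prod_of (fam g) (fam f)) (f k * g l).

Lemma swap_fam k s : Span (prod_of (prs g) (fam f)) (f k * pr g s).
Proof.
elim: s k => [|l s IH] k.
  rewrite pr_nil mulr1 -[f k]mul1r -(pr_nil g).
  by apply: span_gen; apply: prod_ofI; [apply: prsI|apply: famI].
rewrite pr_cons mulrA; apply: span_mulr (swap k l) => _ [_ [_ [[i ->] [j ->] ->]]].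
rewrite -mulrA; apply: span_mull (IH j) => _ [_ [_ [[t ->] [m ->] ->]]].
by rewrite mulrA -pr_cons; apply: span_gen; apply: prod_ofI; [apply: prsI|apply: famI].
Qed.

Lemma swap_prs t s : Span (prod_of (prs g) (prs f)) (pr f t * pr g s).
Proof.
elim: t s => [|k t IH] s.
  rewrite pr_nil mul1r -[pr g s]mulr1 -(pr_nil f).
  by apply: span_gen; apply: prod_ofI; apply: prsI.
rewrite pr_cons -mulrA; apply: span_mull (IH s) => _ [_ [_ [[s' ->] [t' ->] ->]]].
rewrite mulrA; apply: span_mulr (swap_fam k s') => _ [_ [_ [[s2 ->] [j ->] ->]]].
by rewrite -mulrA -pr_cons; apply: span_gen; apply: prod_ofI; apply: prsI.
Qed.

Lemma swap_fam_r s k : Span (prod_of (fam g) (prs f)) (pr f s * g k).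
Proof.
elim: s => [|l s IH] in k *.
  by rewrite pr_nil mul1r -[g k]mulr1 -(pr_nil f); apply: span_gen; apply: prod_ofI; [apply: famI|apply: prsI].
rewrite pr_cons -mulrA; apply: span_mull (IH k) => _ [_ [_ [[i ->] [t ->] ->]]].
rewrite mulrA; apply: span_mulr (swap l i) => _ [_ [_ [[j ->] [m ->] ->]]].
by rewrite -mulrA -pr_cons; apply: span_gen; apply: prod_ofI; [apply: famI|apply: prsI].
Qed.
End Swap.
End Span.

Section Spanning.
Variables (F : fieldType) (q : F) (hq0 : q != 0).
Hypothesis hq : forall n : nat, (0 < n)%N -> q ^+ n != 1.
Local Notation V := (qshuffle hq0).
Local Notation p := (q ^+ 2).
Local Notation O := (@oddalt F q hq0).
Local Notation E := (@evenalt F q hq0).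

Lemma p_root n : (0 < n)%N -> p ^+ n != 1.
Proof. by move=> n0; rewrite -exprM hq // muln_gt0. Qed.

Lemma p_neq1 : 1 - p != 0.
Proof. by rewrite subr_eq0 eq_sym -(expr1 p) p_root. Qed.

Lemma pV_neq1 : 1 - p^-1 != 0.
Proof. by rewrite subr_eq0 eq_sym invr_eq1 -(expr1 p) p_root. Qed.

Lemma p_neqN1 n : (0 < n)%N -> 1 + p^-1 ^+ n != 0.
Proof.
move=> n0; rewrite addrC addr_eq0; apply/negP => /eqP /(congr1 (fun x => x ^+ 2)).
rewrite sqrrN expr1n -exprM exprVn => /eqP; rewrite invr_eq1; apply/negP.
by rewrite p_root // muln_gt0 n0.
Qed.

Definition words (h : V) := exists g : seq bool, h = \prod_(c <- g) O c 0.
Definition Ualg : V -> Prop := Span words.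

Lemma UM f g : Ualg f -> Ualg g -> Ualg (f * g).
Proof.
apply: span_mul => _ _ [s ->] [t ->]; apply: span_gen; exists (s ++ t).
by rewrite big_cat.
Qed.

Lemma U1 : Ualg 1.
Proof. by apply: span_gen; exists [::]; rewrite big_nil. Qed.

Lemma U_O0 b : Ualg (O b 0).
Proof. by apply: span_gen; exists [:: b]; rewrite big_seq1. Qed.

(** [O_On0] yields the difference of the two even words of index [n.+1], and the convolution
    identity yields their combination with coefficients $1$ and $p^{-(n+1)}$ up to products of
    smaller words. The two equations are independent since $1+p^{-(n+1)}\ne0$; then [E_O0] gives the
    odd words. *)
Lemma U_alt n : (forall b, Ualg (E b n)) /\ (forall b, Ualg (O b n)).
Proof.
elim/ltn_ind: n => -[|n] IH; first by split=> b; [exact: U1|exact: U_O0].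
have UE b k : (k <= n)%N -> Ualg (E b k) by move=> kn; case: (IH k kn).
have UO b k : (k <= n)%N -> Ualg (O b k) by move=> kn; case: (IH k kn).
have UES b : Ualg (E b n.+1).
  have H1 c : Ualg (E c n.+1 - E (~~ c) n.+1).
    apply: (spanZK pV_neq1); rewrite -O_On0.
    by apply: spanB; apply: UM; apply: UO.
  have H2 : Ualg (E (~~ b) n.+1 + p^-1 ^+ n.+1 *: E b n.+1).
    have := E_convolution hq0 (~~ b) n.
    rewrite big_ord_recl big_ord_recr /= expr0 scale1r E0 mul1r subn0 negbK.
    rewrite /bump /= add1n subnn E0 mulr1 addrCA => /(canRL (addKr _)) ->.
    apply: spanD; [apply: spanN|]; apply: span_sum => i _; apply: spanZ; apply: UM.
    - by apply: UE; rewrite add1n.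
    - by apply: UE; rewrite add1n subSS leq_subr.
    - by apply: UO; rewrite -ltnS.
    - by apply: UO; rewrite leq_subr.
  apply: (spanZK (p_neqN1 (ltn0Sn n))); rewrite scalerDl scale1r.
  have -> : E b n.+1 + p^-1 ^+ n.+1 *: E b n.+1 = E b n.+1 - E (~~ b) n.+1
    + (E (~~ b) n.+1 + p^-1 ^+ n.+1 *: E b n.+1).
    by rewrite addrA subrK.
  by apply: spanD; [apply: H1|apply: H2].
split=> // b; apply: (spanZK p_neq1); rewrite -E_O0.
by apply: spanB; [|apply: spanZ]; apply: UM => //; apply: U_O0.
Qed.

Lemma U_E b n : Ualg (E b n). Proof. by case: (U_alt n). Qed.
Lemma U_O b n : Ualg (O b n). Proof. by case: (U_alt n). Qed.

Lemma U_pr f s : (forall k, Ualg (f k)) -> Ualg (pr f s).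
Proof.
by move=> Uf; rewrite /pr; apply: big_ind => *; [exact: U1|exact: UM|].
Qed.

Lemma swap_DB b k l : Span (prod_of (fam (O b)) (fam (E (~~ b)))) (E (~~ b) k * O b l).
Proof. by case: (exchange_l hq0 b) => H2 H4; apply: (exch_db _ H2 H4). Qed.
Lemma swap_BD b k l : Span (prod_of (fam (E (~~ b))) (fam (O b))) (O b l * E (~~ b) k).
Proof. by case: (exchange_l hq0 b) => H2 H4; apply: (exch_bd (p_neq0 hq0) _ H2 H4). Qed.
Lemma swap_AB b k l : Span (prod_of (fam (O b)) (fam (E b))) (E b k * O b l).
Proof. by case: (exchange_r hq0 b) => H2 H4; apply: (exch_db _ H2 H4). Qed.
Lemma swap_BA b k l : Span (prod_of (fam (E b)) (fam (O b))) (O b l * E b k).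
Proof.
case: (exchange_r hq0 b) => H2 H4; apply: (exch_bd _ _ H2 H4) => //.
by rewrite invr_neq0 // p_neq0.
Qed.

Arguments swap_DB : clear implicits.
Arguments swap_BD : clear implicits.
Arguments swap_AB : clear implicits.
Arguments swap_BA : clear implicits.

(** * Ordered monomials span $U$ *)

Section Triangular.
Variable b : bool.
Local Notation B := (O b).
Local Notation D := (E (~~ b)).
Local Notation C := (O (~~ b)).
Local Notation A := (E b).

Definition tri_span : V -> Prop := Span (prod_of (prod_of (prs B) (prs D)) (prs C)).

Lemma tri_I s t u : tri_span (pr B s * pr D t * pr C u).
Proof. by apply: span_gen; apply: prod_ofI; [apply: prod_ofI|]; apply: prsI. Qed.

Lemma tri_B k f : tri_span f -> tri_span (B k * f).
Proof.
apply: span_mull => _ [_ [_ [[_ [_ [[s ->] [t ->] ->]]] [u ->] ->]]].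
by rewrite !mulrA -pr_cons; apply: tri_I.
Qed.

Lemma tri_C k f : tri_span f -> tri_span (f * C k).
Proof.
apply: span_mulr => _ [_ [_ [[_ [_ [[s ->] [t ->] ->]]] [u ->] ->]]].
by rewrite -!mulrA -pr_rcons mulrA; apply: tri_I.
Qed.

Lemma tri_prB s f : tri_span f -> tri_span (pr B s * f).
Proof.
move=> Sf; elim: s => [|k s IH]; first by rewrite pr_nil mul1r.
by rewrite pr_cons -mulrA; apply: tri_B.
Qed.

Lemma tri_Dl k f : tri_span f -> tri_span (D k * f).
Proof.
apply: span_mull => _ [_ [_ [[_ [_ [[s ->] [t ->] ->]]] [u ->] ->]]].
rewrite -!mulrA mulrA.
apply: span_mulr (swap_fam (swap_DB b) k s) => _ [_ [_ [[s' ->] [j ->] ->]]].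
by rewrite -!mulrA [D j * _]mulrA -pr_cons mulrA; apply: tri_I.
Qed.

(** $C$ and $D$ are [O] and [E] of the same letter [~~ b], so they are interchanged by the reversed
    relations [exchange_r]. *)
Lemma tri_Dr k f : tri_span f -> tri_span (f * D k).
Proof.
apply: span_mulr => _ [_ [_ [[_ [_ [[s ->] [t ->] ->]]] [u ->] ->]]].
rewrite -mulrA; have H := swap_fam_r (fun k l => swap_BA (~~ b) l k) u k.
apply: span_mull H => _ [_ [_ [[j ->] [u' ->] ->]]].
by rewrite !mulrA -[_ * _ * D j]mulrA -pr_rcons; apply: tri_I.
Qed.

Lemma tri_A n : tri_span (A n).
Proof.
elim/ltn_ind: n => -[|n] IH.
  by have := tri_I [::] [::] [::]; rewrite !pr_nil !mulr1.
have := E_convolution hq0 b n.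
rewrite big_ord_recl /= expr0 scale1r E0 mul1r subn0 => /(canRL (addrK _)) ->.
apply: spanB; apply: span_sum => i _; apply: spanZ.
  have := tri_I [:: i : nat] [::] [:: (n - i)%N].
  by rewrite !pr_cons !pr_nil !mulr1.
by apply: tri_Dl; apply: IH; rewrite /bump add1n subSS ltnS leq_subr.
Qed.

Lemma tri_1 : tri_span 1. Proof. exact: (tri_A 0). Qed.

Lemma tri_ApB n s : tri_span (A n * pr B s).
Proof.
apply: span_sub (swap_fam (swap_AB b) n s) => _ [_ [_ [[s' ->] [j ->] ->]]].
by apply: tri_prB; apply: tri_A.
Qed.

(** Moving $C_0$ past $B_k$ leaves $A_{k+1}-D_{k+1}$, and both of these can be moved through the
    remaining $B$'s. Since $U$ is generated by letters, $C_0$ is the only $C$ that has to be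
    moved. *)
Lemma tri_CpB s : tri_span (C 0 * pr B s).
Proof.
elim: s => [|k s IH].
  by rewrite pr_nil mulr1 -[C 0]mul1r; apply: tri_C; apply: tri_1.
rewrite pr_cons mulrA.
have -> : C 0 * B k = B k * C 0 - (1 - p^-1) *: (A k.+1 - D k.+1).
  by rewrite -O_On0 opprB addrC subrK.
rewrite mulrBl -mulrA; apply: spanB; first exact: tri_B.
rewrite -scalerAl mulrBl; apply: spanZ; apply: spanB; first exact: tri_ApB.
by apply: tri_Dl; rewrite -[pr B s]mulr1; apply: tri_prB; apply: tri_1.
Qed.

(** The span is stable under right multiplication by $C$ and $D$, so those factors are peeled off
    from the right until only $B$'s remain. *)
Lemma tri_C0 f : tri_span f -> tri_span (C 0 * f).
Proof.
apply: span_mull => _ [_ [_ [[_ [_ [[s ->] [t ->] ->]]] [u ->] ->]]].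
rewrite !mulrA; elim/last_ind: u => [|u k IH]; last first.
  by rewrite pr_rcons mulrA; apply: tri_C.
rewrite pr_nil mulr1; elim/last_ind: t => [|t k IH].
  by rewrite pr_nil mulr1; apply: tri_CpB.
by rewrite pr_rcons mulrA; apply: tri_Dr.
Qed.

Lemma Ualg_tri_span f : Ualg f -> tri_span f.
Proof.
apply: span_sub => _ [g ->]; elim: g => [|c g IH].
  by rewrite big_nil; apply: tri_1.
rewrite big_cons; have [<-|/neq_negb ->] := eqVneq b c; first exact: tri_B.
exact: tri_C0.
Qed.

Lemma Ualg_tri_span_swap f : Ualg f -> Span (prod_of (prod_of (prs D) (prs B)) (prs C)) f.
Proof.
move/Ualg_tri_span; apply: span_sub => _ [_ [_ [[_ [_ [[s ->] [t ->] ->]]] [u ->] ->]]].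
have H := swap_prs (fun k l => swap_BD b l k) s t.
apply: span_mulr H => _ [_ [_ [[t' ->] [s' ->] ->]]].
by apply: span_gen; apply: prod_ofI; [apply: prod_ofI|]; apply: prsI.
Qed.

End Triangular.
End Spanning.

(** * Linear independence *)

Section Independence.
Variables (F : fieldType) (T : eqType) (P : pred T).

Definition indep (e : T -> word -> F) :=
  forall (ss : seq T) (c : T -> F), uniq ss -> all P ss ->
    (forall w, \sum_(s <- ss) c s * e s w = 0) -> forall s, s \in ss -> c s = 0.

Lemma sum_pred1_seq (r : seq T) (x : T) (f : T -> F) : uniq r -> x \in r ->
  \sum_(j <- r | j == x) f j = f x.
Proof.
move=> Ur xr; rewrite big_mkcond (bigD1_seq x) //= eqxx.
by rewrite big1 ?addr0 // => i /negPf ->.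
Qed.

(** Expanded relations repeat their indices; independence then kills the sum of the coefficients at
    each index. The condition [P] is asked only of terms with nonzero coefficient, so the others may
    carry arbitrary indices. *)
Lemma indep_coef e : indep e ->
  forall (I : eqType) (r : seq I) (idx : I -> T) (c : I -> F),
  (forall i, i \in r -> c i != 0 -> P (idx i)) ->
  (forall w, \sum_(i <- r) c i * e (idx i) w = 0) ->
  forall t, \sum_(i <- r | idx i == t) c i = 0.
Proof.
move=> He I r0 idx c Pr0 H0 t.
pose r := [seq i <- r0 | c i != 0].
have Er (G : I -> F) (Q : pred I) : (forall i, c i = 0 -> G i = 0) ->
    \sum_(i <- r0 | Q i) G i = \sum_(i <- r | Q i) G i.
  move=> HG; rewrite big_filter_cond [LHS](bigID (fun i => c i != 0)) /=.
  rewrite [X in _ + X]big1 ?addr0; first by apply: eq_bigl => i; rewrite andbC.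
  by move=> i /andP[_]; rewrite negbK => /eqP/HG.
have Pr i : i \in r -> P (idx i) by rewrite mem_filter => /andP[ci /Pr0]; apply.
have H w : \sum_(i <- r) c i * e (idx i) w = 0.
  by rewrite -Er // => i ->; rewrite mul0r.
rewrite Er //; move: Pr H; move: {Pr0 H0 Er} r => r Pr H.
have [tr|tr] := boolP (t \in map idx r); last first.
  rewrite big1_seq // => i /andP[/eqP it ir]; case/negP: tr.
  by rewrite -it map_f.
pose ss := undup (map idx r).
apply: (He ss (fun t => \sum_(i <- r | idx i == t) c i)).
- exact: undup_uniq.
- by apply/allP => x; rewrite mem_undup => /mapP[i ir ->]; apply: Pr.
- move=> w; rewrite -[RHS](H w).
  under eq_bigr => x _ do rewrite big_distrl /=.
  rewrite (exchange_big_dep predT) //= big_seq [RHS]big_seq.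
  apply: eq_bigr => i ir; under eq_bigl => x do rewrite eq_sym.
  by rewrite (sum_pred1_seq (fun x => c i * e x w)) ?undup_uniq // mem_undup map_f.
- by rewrite mem_undup.
Qed.

Lemma indep_scale e e' : indep e ->
  (forall t, exists k : F, k != 0 /\ forall w, e' t w = k * e t w) -> indep e'.
Proof.
move=> He /choice [k Hk] ss c Us Ps H s sss.
have [k0 _] := Hk s; apply: (mulIf k0); rewrite mul0r.
apply: (He ss (fun s => c s * k s)) => // w; rewrite -[RHS](H w).
by apply: eq_bigr => t _; have [_ ->] := Hk t; rewrite mulrA.
Qed.

(** Both measures are bounded on the finite list, so descending lexicographic induction terminates.
    It makes the coefficients of larger terms vanish before the current one is treated. *)
Lemma down_ind (ss : seq T) (m1 m2 : T -> nat) (Q : T -> Prop) :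
  (forall s, s \in ss -> (forall t, t \in ss ->
     (m1 s < m1 t)%N || (m1 s == m1 t) && (m2 s < m2 t)%N -> Q t) -> Q s) ->
  forall s, s \in ss -> Q s.
Proof.
move=> H.
pose N1 := \max_(s <- ss) m1 s; pose N2 := \max_(s <- ss) m2 s.
have L1 s : s \in ss -> (m1 s <= N1)%N by move=> sss; apply: leq_bigmax_seq.
have L2 s : s \in ss -> (m2 s <= N2)%N by move=> sss; apply: leq_bigmax_seq.
suff G n : forall s, s \in ss -> ((N1 - m1 s) * N2.+1 + (N2 - m2 s) < n)%N -> Q s.
  by move=> s sss; apply: (G _ s sss (ltnSn _)).
elim: n => // n IH s sss Hn; apply: H => // t tss Ht; apply: IH => //.
suff lt : ((N1 - m1 t) * N2.+1 + (N2 - m2 t)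
    < (N1 - m1 s) * N2.+1 + (N2 - m2 s))%N by apply: leq_trans lt Hn.
have h1 := L1 t tss; have h2 := L2 s sss; have h3 := L2 t tss.
case/orP: Ht => [lt1|/andP[/eqP -> lt2]]; last by rewrite ltn_add2l; lia.
have : ((N1 - m1 t).+1 * N2.+1 <= (N1 - m1 s) * N2.+1)%N by rewrite leq_mul2r; lia.
by rewrite mulSn; lia.
Qed.
End Independence.

(* Zeros are dropped since [E b 0 = 1], and the shift by one matches the
   indexing of [evenalt1]. *)
Definition npos (s : seq nat) : seq nat :=
  map predn (sort leq [seq k <- s | (0 < k)%N]).

Lemma perm_npos s :
  perm_eq s (nseq (size s - size (npos s)) 0%N ++ map succn (npos s)).
Proof.
have E : map succn (npos s) = sort leq [seq k <- s | (0 < k)%N].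
  rewrite /npos -map_comp map_id_in // => k /=.
  by rewrite mem_sort mem_filter => /andP[/prednK].
have H := perm_filterC (fun k => 0 < k)%N s.
have Z : all (pred1 0%N) [seq k <- s | predC (fun k => 0 < k)%N k].
  by apply/allP => k; rewrite mem_filter /= -eqn0Ngt => /andP[].
rewrite E -H perm_catC (elimT (all_pred1P _ _) Z).
rewrite size_map size_sort !size_filter -(count_predC (fun k => 0 < k)%N) addKn.
by rewrite perm_cat2l perm_sym perm_sort.
Qed.

Lemma npos_sorted s : sorted leq (npos s).
Proof.
rewrite sorted_map; apply: (sub_sorted _ (sort_sorted leq_total _)) => a b /=.
by lia.
Qed.

(** The common size tells how many zeros [npos] has dropped. *)
Lemma npos_inj s t : sorted leq s -> sorted leq t -> size s = size t ->
  npos s = npos t -> s = t.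
Proof.
move=> Ss St Est E; apply: (sorted_eq leq_trans anti_leq Ss St).
by rewrite (permPl (perm_npos s)) E Est perm_sym perm_npos.
Qed.

Lemma size_sumn_npos s : (size (npos s) + sumn (npos s))%N = sumn s.
Proof.
rewrite (perm_sumn (perm_npos s)) sumn_cat sumn_nseq mul0n add0n.
by elim: (npos s) => //= k r IH; lia.
Qed.

Lemma npos_nil s : (npos s == [::]) = (sumn s == 0)%N.
Proof.
by rewrite -size_sumn_npos; case: (npos s) => [|k r].
Qed.

(** Index set of an expanded product of deconcatenations: every entry [k] is cut as $j+(k-j)$. *)
Fixpoint splits (s : seq nat) : seq (seq nat * seq nat) :=
  if s is k :: s' then
    [seq (j :: J.1, (k - j)%N :: J.2) | j <- iota 0 k.+1, J <- splits s']
  else [:: ([::], [::])].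

Lemma splitsP s J : J \in splits s ->
  [/\ size J.1 = size s, size J.2 = size s & (sumn J.1 + sumn J.2 = sumn s)%N].
Proof.
elim: s J => [|k s IH] J; first by rewrite inE => /eqP ->.
move=> /allpairsPdep[j [J' []]]; rewrite mem_iota => /andP[_ jk] /IH[H1 H2 H3] ->.
by split; rewrite /= ?H1 ?H2 // -H3 addnACA subnKC.
Qed.

Section BigSplits.
Variables (R : nmodType) (f : seq nat * seq nat -> R).

Lemma big_splits_l s :
  \sum_(J <- splits s | sumn J.1 == 0%N) f J = f (nseq (size s) 0%N, s).
Proof.
elim: s f => [|k s IH] g ; first by rewrite big_cons big_nil addr0.
rewrite big_mkcond big_allpairs_dep /= big_cons [X in _ + X]big1_seq ?addr0.
  by rewrite -big_mkcond /= (IH (fun J => g (0%N :: J.1, (k - 0)%N :: J.2))) subn0.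
move=> j /andP[_]; rewrite mem_iota => /andP[j0 _].
by apply: big1 => J _; rewrite addn_eq0 eqn0Ngt j0.
Qed.

Lemma big_splits_r s :
  \sum_(J <- splits s | sumn J.2 == 0%N) f J = f (s, nseq (size s) 0%N).
Proof.
elim: s f => [|k s IH] g; first by rewrite big_cons big_nil addr0.
rewrite big_mkcond big_allpairs_dep -[k.+1]addn1 iotaD big_cat /= big_seq1 add0n.
rewrite big1_seq ?add0r.
  by rewrite subnn -big_mkcond /= (IH (fun J => g (k :: J.1, 0%N :: J.2))).
move=> j /andP[_]; rewrite mem_iota => /andP[_ jk].
by apply: big1 => J _; rewrite addn_eq0 subn_eq0 leqNgt jk.
Qed.
End BigSplits.

(** * Deconcatenation at prefixes of maximal excess *)

Section Top.
Variables (F : fieldType) (q : F) (hq0 : q != 0).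
Local Notation V := (qshuffle hq0).
Local Notation p := (q ^+ 2).
Local Notation O := (@oddalt F q hq0).
Local Notation E := (@evenalt F q hq0).
Implicit Types (f g : V) (t : seq (V * V)).

(* [f] is homogeneous of excess [x], has no prefix of excess larger than [e],
   and [t] is its deconcatenation at the prefixes of excess [e]. *)
Definition top (b : bool) (e x : int) f t :=
  [/\ homog b x f, forall u v, e < excess b u -> f (u ++ v) = 0,
      forall u v, excess b u = e -> f (u ++ v) = \sum_(r <- t) r.1 u * r.2 v
    & forall r, r \in t -> homog b e r.1].

Lemma homog_der b x a f : homog b x f -> homog b (x - lsign b a) (der a f).
Proof. by move=> H w /H; rewrite excess_cons => <-; rewrite addrC addKr. Qed.

(** A prefix of a shuffle is a shuffle of prefixes, and their excesses add. At the empty prefix one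
    of the two bounds is negative, which forces that factor to be zero. *)
Lemma mul_vanish b e e' f g u v :
  (forall u v, e < excess b u -> f (u ++ v) = 0) ->
  (forall u v, e' < excess b u -> g (u ++ v) = 0) ->
  e + e' < excess b u -> (f * g) (u ++ v) = 0.
Proof.
elim: u e e' f g => [|a u IH] e e' f g Hf Hg.
  rewrite excess_nil => H.
  have [e0|e0] := ltP e 0.
    have -> : f = 0 by apply/funext => w; apply: (Hf [::]); rewrite excess_nil.
    by rewrite mul0r.
  have -> : g = 0 by apply/funext => w; apply: (Hg [::]); rewrite excess_nil; lia.
  by rewrite mulr0.
rewrite excess_cons cat_cons mul_cons => H.
rewrite (IH (e - lsign b a) e') ?add0r //; last by lia.
  rewrite (IH e (e' - lsign b a)) //; last by lia.
    by move=> u' v' Hu; rewrite /tw Hf ?mulr0.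
  by move=> u' v' Hu; apply: (Hg (a :: u')); rewrite excess_cons; lia.
by move=> u' v' Hu; apply: (Hf (a :: u')); rewrite excess_cons; lia.
Qed.

(* The deconcatenation is multiplicative up to the power of [q] produced by the
   right part of [f] crossing the left part of [g].  Maximality of the excess
   makes that power independent of the terms. *)
Lemma mul_top b e x f t e' x' g t' u v : top b e x f t -> top b e' x' g t' ->
  excess b u = e + e' ->
  (f * g) (u ++ v) = qpow q ((x - e) * e') *
    \sum_(r <- t) \sum_(r' <- t') (r.1 * r'.1) u * (r.2 * r'.2) v.
Proof.
elim: u e x f t e' x' g t' => [|a u IH] e x f t e' x' g t' [Hf1 Hf2 Hf3 Hf4] [Hg1 Hg2 Hg3 Hg4].
  rewrite excess_nil => H.
  have [e0|e0] := eqVneq e 0; last first.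
    have -> : (f * g) ([::] ++ v) = 0.
      have [e1|e1] := ltP e 0.
        have -> : f = 0 by apply/funext => w; apply: (Hf2 [::]); rewrite excess_nil.
        by rewrite mul0r.
      have -> : g = 0 by apply/funext => w; apply: (Hg2 [::]); rewrite excess_nil; lia.
      by rewrite mulr0.
    rewrite big1_seq ?mulr0 // => r /andP[_ rt]; rewrite big1 // => r' _.
    rewrite mul_nil (_ : r.1 [::] = 0) ?mul0r //.
    have [//|/(Hf4 _ rt)] := eqVneq (r.1 [::]) 0.
    by rewrite excess_nil => /esym/eqP; rewrite (negPf e0).
  have e'0 : e' = 0 by lia.
  rewrite e'0 mulr0 qpow0 mul1r.
  have -> : f = \sum_(r <- t) r.1 [::] *: r.2.
    by apply/funext => w; rewrite sumE (Hf3 [::]) // excess_nil.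
  have -> : g = \sum_(r <- t') r.1 [::] *: r.2.
    by apply/funext => w; rewrite sumE (Hg3 [::]) // excess_nil.
  rewrite big_distrl sumE; apply: eq_bigr => r _.
  rewrite big_distrr sumE; apply: eq_bigr => r' _.
  by rewrite /= mul_nil -scalerAl -scalerAr scalerA scaleE.
rewrite excess_cons => H; rewrite cat_cons mul_cons.
pose d (t : seq (V * V)) := [seq (der a r.1, r.2) | r <- t].
have topd e1 x1 f1 t1 : top b e1 x1 f1 t1 ->
    top b (e1 - lsign b a) (x1 - lsign b a) (der a f1) (d t1).
  move=> [H1 H2 H3 H4]; split.
  - exact: homog_der.
  - by move=> u' v' Hu; apply: (H2 (a :: u')); rewrite excess_cons; lia.
  - move=> u' v' Hu; rewrite big_map /=; apply: (H3 (a :: u')).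
    by rewrite excess_cons; lia.
  - by move=> _ /mapP[r /H4 rt ->]; apply: homog_der.
have tf : top b e x f t by [].
have tg : top b e' x' g t' by [].
rewrite (tw_homog _ Hf1) -scalerAl scaleE.
rewrite (IH _ _ _ _ _ _ _ _ (topd _ _ _ _ tf) tg); last by lia.
rewrite (IH _ _ _ _ _ _ _ _ tf (topd _ _ _ _ tg)); last by lia.
rewrite !big_map /=.
have -> : x - lsign b a - (e - lsign b a) = x - e by lia.
rewrite mulrA -qpowD //.
(* A letter of [g] crosses all of [f] on the left side, hence [x], but only the left part of [f] on
   the right side, hence [e]; lowering [e'] by that letter accounts for the difference. *)
have -> : lsign b a * x + (x - e) * (e' - lsign b a) = (x - e) * e' + lsign b a * e by lia.
rewrite qpowD // -mulrA -mulrDr; congr (_ * _).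
rewrite mulr_sumr -big_split /=; apply: eq_big_seq => r rt.
rewrite big_map mulr_sumr -big_split /=; apply: eq_bigr => r' _.
rewrite mul_cons (tw_homog _ (Hf4 r rt)) -scalerAl scaleE mulrDl.
by rewrite mulrA.
Qed.
Lemma topM b e x f t e' x' g t' : top b e x f t -> top b e' x' g t' ->
  top b (e + e') (x + x') (f * g)
    [seq (qpow q ((x - e) * e') *: (r.1 * r'.1), r.2 * r'.2) | r <- t, r' <- t'].
Proof.
move=> tf tg; have [Hf1 Hf2 _ Hf4] := tf; have [Hg1 Hg2 _ Hg4] := tg; split.
- exact: homogM.
- by move=> u v; apply: mul_vanish.
- move=> u v Hu; rewrite (mul_top _ tf tg Hu) big_allpairs_dep mulr_sumr.
  apply: eq_bigr => r _; rewrite mulr_sumr; apply: eq_bigr => r' _.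
  by rewrite /= scaleE mulrA.
- move=> r /allpairsPdep[r1 [r2 [/Hf4 H1 /Hg4 H2 ->]]] /= w.
  by rewrite scaleE mulf_eq0 negb_or => /andP[_]; apply: (homogM H1 H2).
Qed.

Lemma top1 b : top b 0 0 1 [:: (1, 1)].
Proof.
split.
- exact: homog1.
- by move=> [|a u] v; rewrite ?excess_nil // oneE.
- move=> u v _; rewrite big_seq1 -[RHS]/((1 : V) u * (1 : V) v) !oneE.
  by case: u => [|a u]; rewrite ?mul1r ?mul0r.
- by move=> r; rewrite inE => /eqP ->; apply: homog1.
Qed.

Lemma altw_split a n u v :
  altw hq0 a n (u ++ v)
  = \sum_(i < n.+1) altw hq0 a i u * altw hq0 (a (+) odd i) (n - i) v.
Proof.
elim: u a n => [|c u IH] a n.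
  rewrite big_ord_recl big1 => [|i _]; last by rewrite lift0 altw_nil mul0r.
  have -> : altw hq0 a (@ord0 n) [::] = 1 by [].
  by rewrite addr0 subn0 /= addbF mul1r.
have E i : altw hq0 a i (c :: u) = if i is i'.+1 then
    (if c == a then altw hq0 (~~ a) i' u else 0) else 0.
  by rewrite -/(der c (altw hq0 a i) u) der_altw; case: i => // i; case: ifP.
rewrite cat_cons -/(der c (altw hq0 a n) (u ++ v)) der_altw.
case: n => [|n]; first by rewrite big_ord1 E mul0r.
rewrite big_ord_recl E mul0r add0r; case: ifP => ca; last first.
  by rewrite big1 // => i _; rewrite lift0 E ca mul0r.
rewrite IH; apply: eq_bigr => i _; rewrite lift0 E ca subSS.
by rewrite addNb -addbN.
Qed.

Lemma sum_pair m (f : nat -> F) :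
  \sum_(i < 2 * m) f i = \sum_(j < m) (f (2 * j)%N + f (2 * j).+1).
Proof.
elim: m => [|m IH]; first by rewrite muln0 !big_ord0.
by rewrite mulnS !big_ord_recr /= IH addrA.
Qed.

Definition fam_top b e x (f g h : nat -> V) :=
  forall k, top b e x (f k) [seq (g j, h (k - j)%N) | j <- iota 0 k.+1].

Lemma altw_zero b a n u : excess b u != lsign b a * (odd n)%:Z -> altw hq0 a n u = 0.
Proof.
rewrite /altw /ind; case: (u =P alt a n) => [->|//].
by rewrite (excess_lsign a) excess_alt lsignC eqxx.
Qed.

Lemma iota_sum k (f : nat -> F) :
  \sum_(j <- iota 0 k.+1) f j = \sum_(j < k.+1) f j.
Proof. by rewrite -(big_mkord xpredT f) /index_iota subn0. Qed.

(** The excess of a prefix of an alternating word depends only on the parity of its length. Here and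
    in [top_Es] the maximal prefixes have odd length, in [top_E] and [top_On] even length. *)
Lemma top_O b : fam_top b 1 1 (O b) (O b) (E (~~ b)).
Proof.
move=> k; split; first exact: homog_O.
- move=> u v Hu; rewrite /O /E altw_split big1 // => i _; rewrite (@altw_zero b) ?mul0r //.
  by rewrite /lsign eqxx mul1r; case: odd; lia.
- move=> u v Hu; rewrite big_map iota_sum /O /E altw_split.
  rewrite (_ : (2 * k).+2 = 2 * k.+1)%N; last by rewrite mulnS.
  apply: etrans (sum_pair k.+1 (fun i => altw hq0 b i u * altw hq0 (b (+) odd i) ((2 * k).+1 - i) v)) _.
  apply: eq_bigr => j _; rewrite (@altw_zero b _ (2 * j)) ?mul0r ?add0r; last first.
    by rewrite Hu mul2n odd_double mulr0.
  have -> : ((2 * k).+1 - (2 * j).+1 = 2 * (k - j))%N by lia.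
  by rewrite (_ : odd (2 * j).+1 = true) ?addbT // /= mul2n odd_double.
- by move=> r /mapP[j _ ->]; apply: homog_O.
Qed.

Lemma top_E b : fam_top b 0 0 (E (~~ b)) (E (~~ b)) (E (~~ b)).
Proof.
move=> k; split; first exact: homog_E.
- move=> u v Hu; rewrite /O /E altw_split big1 // => i _; rewrite (@altw_zero b) ?mul0r //.
  by move: Hu; rewrite /lsign; case: b => /=; case: odd; lia.
- move=> u v Hu; rewrite big_map iota_sum /O /E altw_split.
  rewrite !big_ord_recr /=.
  rewrite [X in X + _ = _](sum_pair k (fun i => altw hq0 (~~ b) i u * altw hq0 ((~~ b) (+) odd i) (2 * k - i) v)).
  rewrite (_ : odd (2 * k) = false) ?addbF ?subnn; last by rewrite mul2n odd_double.
  congr (_ + _).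
  apply: eq_bigr => j _; rewrite (@altw_zero b _ (2 * j).+1) ?mul0r ?addr0; last first.
    by rewrite Hu /lsign /= mul2n odd_double; clear; case: b.
  have -> : (2 * k - 2 * j = 2 * (k - j))%N by lia.
  by rewrite (_ : odd (2 * j) = false) ?addbF // mul2n odd_double.
- by move=> r /mapP[j _ ->]; apply: homog_E.
Qed.

Lemma top_On b : fam_top b 0 (- 1) (O (~~ b)) (E (~~ b)) (O (~~ b)).
Proof.
move=> k; split; first exact: homog_On.
- move=> u v Hu; rewrite /O /E altw_split big1 // => i _; rewrite (@altw_zero b) ?mul0r //.
  by move: Hu; rewrite /lsign; case: b => /=; case: odd; lia.
- move=> u v Hu; rewrite big_map iota_sum /O /E altw_split.
  rewrite (_ : (2 * k).+2 = 2 * k.+1)%N; last by rewrite mulnS.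
  apply: etrans (sum_pair k.+1 (fun i => altw hq0 (~~ b) i u * altw hq0 ((~~ b) (+) odd i) ((2 * k).+1 - i) v)) _.
  apply: eq_bigr => j _; rewrite (@altw_zero b _ (2 * j).+1) ?mul0r ?addr0; last first.
    by rewrite Hu /lsign /= mul2n odd_double; clear; case: b.
  have jk : (j <= k)%N by rewrite -ltnS.
  have -> : ((2 * k).+1 - 2 * j = (2 * (k - j)).+1)%N by lia.
  by rewrite (_ : odd (2 * j) = false) ?addbF // mul2n odd_double.
- by move=> r /mapP[j _ ->]; apply: homog_E.
Qed.

(** The shift skips the empty word, as [Om_G] does, and makes the indices of two odd words with
    concatenation [Es b k] add up to [k]. *)
Definition evenalt1 (b : bool) (l : nat) : V := E b l.+1.
Local Notation Es := evenalt1.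

Lemma top_Es b : fam_top b 1 0 (Es b) (O b) (O (~~ b)).
Proof.
move=> k; split; first exact: homog_E.
- move=> u v Hu; rewrite /Es /O /E altw_split big1 // => i _; rewrite (@altw_zero b) ?mul0r //.
  by rewrite /lsign eqxx mul1r; case: odd; lia.
- move=> u v Hu; rewrite big_map iota_sum /Es /O /E altw_split.
  rewrite big_ord_recr /= (@altw_zero b _ (2 * k.+1)) ?mul0r ?addr0; last first.
    by rewrite Hu mul2n odd_double mulr0.
  apply: etrans (sum_pair k.+1 (fun i => altw hq0 b i u * altw hq0 (b (+) odd i) (2 * k.+1 - i) v)) _.
  apply: eq_bigr => j _; rewrite (@altw_zero b _ (2 * j)) ?mul0r ?add0r; last first.
    by rewrite Hu mul2n odd_double mulr0.
  have jk : (j <= k)%N by rewrite -ltnS.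
  have -> : (2 * k.+1 - (2 * j).+1 = (2 * (k - j)).+1)%N by lia.
  by rewrite (_ : odd (2 * j).+1 = true) ?addbT // /= mul2n odd_double.
- by move=> r /mapP[j _ ->]; apply: homog_O.
Qed.

Lemma top_pr b e x (f g h : nat -> V) : fam_top b e x f g h ->
  exists c : nat -> F, (forall n, c n != 0) /\
  forall s, top b (e *+ size s) (x *+ size s) (pr f s)
    [seq (c (size s) *: pr g J.1, pr h J.2) | J <- splits s].
Proof.
(* A factor placed in front of [i] others has right part of excess [x - e], which crosses left parts
   of total excess $i e$. *)
move=> Ht; pose c n := \prod_(i < n) qpow q ((x - e) * (e *+ i)).
exists c; split=> [n|s].
  by apply/prodf_neq0 => i _; apply: qpow_neq0.
elim: s => [|k s IH].
  rewrite !pr_nil !mulr0n /= /c big_ord0 !pr_nil scale1r; exact: top1.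
have := topM (Ht k) IH; rewrite !pr_cons -!mulrS.
congr top; rewrite allpairs_mapl allpairs_mapr map_allpairs.
apply: eq_allpairs => j J /=; rewrite !pr_cons.
by rewrite -scalerAr scalerA /c big_ord_recr mulrC.
Qed.

End Top.

(** * Independence within one family *)

Section Single.
Variables (F : fieldType) (q : F) (hq0 : q != 0).
Hypothesis hq : forall n : nat, (0 < n)%N -> q ^+ n != 1.
Local Notation V := (qshuffle hq0).
Local Notation p := (q ^+ 2).
Local Notation O := (@oddalt F q hq0).
Local Notation E := (@evenalt F q hq0).
Local Notation Es := (@evenalt1 F q hq0).

Definition length_homog (m : nat) (f : V) := forall w, f w != 0 -> size w = m.

Lemma length_homogM m n f g :
  length_homog m f -> length_homog n g -> length_homog (m + n) (f * g).
Proof.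
move=> + + w; elim: w m n f g => [|a w IH] m n f g Hf Hg.
  by rewrite mul_nil mulf_eq0 negb_or => /andP[/Hf <- /Hg <-].
rewrite mul_cons => H.
have [H0|] := eqVneq ((der a f * g) w) 0.
  move: H; rewrite H0 add0r; case: n Hg => [|n] Hg H.
    have D0 : der a g = 0.
      by apply/funext => u; apply/eqP; apply: contraT => /Hg.
    by rewrite D0 mulr0 eqxx in H.
  rewrite addnS /= (IH m n _ _ _ _ H) // => [u|u /Hg [] //].
  by rewrite /tw mulf_eq0 negb_or => /andP[_ /Hf].
case: m Hf => [|m] Hf.
  have D0 : der a f = 0 by apply/funext => u; apply/eqP; apply: contraT => /Hf.
  by rewrite D0 mul0r eqxx.
by move=> {}H; rewrite /= (IH m n _ _ _ _ H) // => u /Hf [].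
Qed.

Lemma length_altw b n : length_homog n (altw hq0 b n).
Proof.
move=> w; rewrite /altw /ind; case: (w =P alt b n) => [->|]; first by rewrite size_alt.
by rewrite eqxx.
Qed.

Lemma length_pr f (m : nat -> nat) s : (forall k, length_homog (m k) (f k)) ->
  length_homog (sumn (map m s)) (pr f s).
Proof.
move=> H; elim: s => [|k s IH]; last by rewrite pr_cons; apply: length_homogM.
by rewrite pr_nil => w; rewrite oneE; case: w => //=; rewrite eqxx.
Qed.

Lemma length_prO b s : length_homog (size s + 2 * sumn s) (pr (O b) s).
Proof.
have -> : (size s + 2 * sumn s)%N = sumn (map (fun k => (2 * k).+1) s).
  by elim: s => //= k s; lia.
by apply: length_pr => k; apply: length_altw.
Qed.

(** The $q$-integer $1+p+\cdots+p^{n-1}$. *)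
Fixpoint qint (n : nat) : F := if n is m.+1 then 1 + p * qint m else 0.

Lemma qint_neq0 n : (0 < n)%N -> qint n != 0.
Proof.
move=> n0; have H m : (1 - p) * qint m = 1 - p ^+ m.
  elim: m => [|m IH]; first by rewrite mulr0 subrr.
  by rewrite /= mulrDr mulr1 mulrCA IH [p ^+ m.+1]exprS mulrBr mulr1 addrA subrK.
apply: contraNneq (p_root hq n0) => q0.
by move: (H n); rewrite q0 mulr0 => /esym/subr0_eq <-.
Qed.

Lemma der_power b n : der b (O b 0 ^+ n) = qint n *: O b 0 ^+ n.-1.
Proof.
elim: n => [|n IH]; first by rewrite scale0r.
rewrite exprS derM der_O E0 mul1r tw_O IH -scalerAl -scalerAr scalerA.
case: n {IH} => [|n] /=; first by rewrite !mulr0 scale0r !addr0 scale1r.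
by rewrite -exprS scalerDl scale1r.
Qed.

Lemma pr_nseq (f : nat -> V) n k : pr f (nseq n k) = f k ^+ n.
Proof. by elim: n => [|n IH]; rewrite ?pr_nil //= pr_cons IH exprS. Qed.

(** By [der_power] this value is the $q$-factorial, the product of [qint 1] up to [qint n]. *)
Lemma power_eval b n : (O b 0 ^+ n) (nseq n b) != 0.
Proof.
elim: n => [|n IH]; first by rewrite expr0 oneE oner_eq0.
rewrite -[X in X != 0]/(der b (O b 0 ^+ n.+1) (nseq n b)) der_power scaleE.
by rewrite mulf_neq0 ?qint_neq0.
Qed.

Lemma excess_nseq b n : excess b (nseq n b) = n%:Z.
Proof.
by elim: n => [|n IH]; rewrite ?excess_nil //= excess_cons IH /lsign eqxx; lia.
Qed.

(** The prefix $b^n$ has length equal to its excess, while [pr (O b) J] has length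
    [size J + 2 * sumn J]. Only the splitting with all left indices zero survives, so a single
    product of right parts remains. *)
Lemma eval_fam b x f h : fam_top b 1 x f (O b) h ->
  exists c : nat -> F, [/\ forall n, c n != 0,
    forall s v, pr f s (nseq (size s) b ++ v) = c (size s) * pr h s v
  & forall s n v, (size s < n)%N -> pr f s (nseq n b ++ v) = 0].
Proof.
move=> /top_pr[c [c0 Hc]].
exists (fun n => c n * (O b 0 ^+ n) (nseq n b)); split.
- by move=> n; rewrite mulf_neq0 ?power_eval.
- move=> s v; have [_ _ H _] := Hc s.
  rewrite H ?excess_nseq ?natz // big_map /=.
  rewrite (bigID (fun J => sumn J.1 == 0%N)) /= big_splits_l /=.
  rewrite big1_seq ?addr0 ?scaleE ?pr_nseq // => J /andP[J0 /splitsP[J1 _ _]].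
  rewrite scaleE; have [->|/length_prO] := eqVneq (pr (O b) J.1 (nseq (size s) b)) 0.
    by rewrite mulr0 mul0r.
  by rewrite size_nseq J1 => len; move: J0; rewrite (_ : sumn J.1 = 0%N) //; lia.
- move=> s n v sn; have [_ H _ _] := Hc s; apply: H.
  by rewrite excess_nseq natz ltz_nat.
Qed.

(** The quantities bounded here and in [srtE] are the word lengths of the monomials in [O b] and
    [Es b]. *)
Definition srt d (s : seq nat) := sorted leq s && (size s + 2 * sumn s < d)%N.
Definition srtE d (s : seq nat) := sorted leq s && (2 * size s + 2 * sumn s < d)%N.

Lemma pr_sort (f : nat -> V) s : (forall k l, f k * f l = f l * f k) ->
  pr f (sort leq s) = pr f s.
Proof. by move=> fC; apply: pr_perm => //; rewrite perm_sort. Qed.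

Lemma pr_npos b s : pr (Es b) (npos s) = pr (E b) s.
Proof.
rewrite (pr_perm (E_comm hq0 b) (perm_npos s)) pr_cat pr_nseq expr1n mul1r.
by rewrite /pr big_map.
Qed.

Lemma Es_comm b k l : Es b k * Es b l = Es b l * Es b k.
Proof. exact: E_comm. Qed.

Lemma eval_relation b x f h (ss : seq (seq nat)) (c : seq nat -> F) n :
  fam_top b 1 x f (O b) h ->
  (forall s, s \in ss -> (n < size s)%N -> c s = 0) ->
  (forall w, \sum_(s <- ss) c s * pr f s w = 0) ->
  forall v, \sum_(s <- ss) (if size s == n then c s else 0) * pr h s v = 0.
Proof.
move=> /eval_fam[k [k0 H1 H2]] Hc H v.
apply: (mulfI (k0 n)); rewrite mulr0 -[RHS](H (nseq n b ++ v)) mulr_sumr.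
apply: eq_big_seq => s sss; case: (ltngtP (size s) n) => sn.
- by rewrite H2 // mulr0 mul0r mulr0.
- by rewrite Hc // !mul0r mulr0.
- by rewrite -sn H1 mulrCA.
Qed.

Lemma pr_Es_nil b s : s != [::] -> pr (Es b) s [::] = 0.
Proof. by case: s => // k s _; rewrite pr_cons mul_nil /Es E_nil mul0r. Qed.

(* Taking the prefix b^n turns products of n letters [O b] into products of
   [E (~~ b)], and products of n letters [Es b] into products of [O (~~ b)]. *)
Lemma indep_single d :
  (forall b, indep (srt d) (pr (O b))) /\ (forall b, indep (srtE d) (pr (Es b))).
Proof.
elim: d => [|d [IHO IHE]].
  by split=> b ss c _ /allP H _ s /H; rewrite /srt /srtE ltn0 andbF.
(* Here [s0] can be taken nonempty, so stripping the prefix strictly shortens the words and level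
   [d] of [IHO] applies. *)
have HE b : indep (srtE d.+1) (pr (Es b)).
  move=> ss c Uss /allP Pss H.
  apply: (@down_ind _ ss size (fun=> 0%N)) => s0 s0s Hs.
  have [/size0nil s00|s0n] := posnP (size s0).
    move: (H [::]); rewrite (bigD1_seq s0) //= s00 pr_nil oneE mulr1.
    by rewrite big1 ?addr0 // => s /pr_Es_nil ->; rewrite mulr0.
  have Hc s : s \in ss -> (size s0 < size s)%N -> c s = 0.
    by move=> sss lt; apply: Hs => //; rewrite lt.
  have R := eval_relation (top_Es hq0 b) Hc H.
  have := indep_coef (IHO (~~ b)) (idx := id) _ R s0.
  rewrite sum_pred1_seq // eqxx; apply.
  move=> s sss; case: (size s =P size s0) => [E _|_]; last by rewrite eqxx.
  have /andP[Ss] := Pss s sss; rewrite /srt Ss E /=. by move: s0n; move: (size s0) (sumn s) => n m; lia.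
split=> // b ss c Uss /allP Pss H.
apply: (@down_ind _ ss size (fun=> 0%N)) => s0 s0s Hs.
have Hc s : s \in ss -> (size s0 < size s)%N -> c s = 0.
  by move=> sss lt; apply: Hs => //; rewrite lt.
have R := eval_relation (top_O hq0 b) Hc H.
have {}R v : \sum_(s <- ss) (if size s == size s0 then c s else 0)
    * pr (Es (~~ b)) (npos s) v = 0.
  by rewrite -[RHS](R v); apply: eq_bigr => s _; rewrite pr_npos.
(* An empty product loses no letter, so the bound stays [d.+1]. All remaining terms have the size of
   [s0], which lets [npos_inj] recover the dropped zeros. *)
have := indep_coef (HE (~~ b)) (idx := npos) _ R (npos s0).
rewrite big_mkcond (bigD1_seq s0) //= !eqxx big1_seq ?addr0.
  apply=> s sss; case: (size s =P size s0) => [E _|_]; last by rewrite eqxx.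
  have /andP[Ss] := Pss s sss; rewrite /srtE npos_sorted /= E.
  move: (size_sumn_npos s); move: (size (npos s)) (sumn (npos s)) (sumn s) => a a' a''.
  by move: (size s0) => n; lia.
move=> s /andP[ss0 sss]; case: eqP => // En; case: eqP => // Es.
have /andP[Ss _] := Pss s sss; have /andP[Ss0 _] := Pss s0 s0s.
by move: ss0; rewrite (npos_inj Ss Ss0 Es En) eqxx.
Qed.

Lemma indep_O b : indep (sorted leq) (pr (O b)).
Proof.
move=> ss c Uss /allP Pss H s sss.
pose d := (\max_(s <- ss) (size s + 2 * sumn s)).+1%N.
have [/(_ b) HO _] := indep_single d.
apply: (HO ss c) => //; apply/allP => t tss; rewrite /srt Pss //= ltnS.
exact: (@leq_bigmax_seq _ ss xpredT (fun s => (size s + 2 * sumn s)%N)).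
Qed.
End Single.

(** * Replacing $q$ by $1/q$ *)

Section Inverse.
Variables (F : fieldType) (q : F) (hq0 : q != 0) (hqV : q^-1 != 0).
Local Notation V := (qshuffle hq0).
Local Notation V' := (qshuffle hqV).

Lemma qpowV n : qpow q^-1 n = qpow q (- n).
Proof. by rewrite /qpow exprVn exprz_inv. Qed.

(* A letter of [f] that does not cross a letter of [g] is crossed by it, so the
   exponents in the two products are complementary. *)
Lemma star_inv b x y (f g : word -> F) w :
  @homog F q hq0 b x f -> @homog F q hq0 b y g ->
  star q^-1 w f g = qpow q (- (x * y)) * star q w g f.
Proof.
elim: w x y f g => [|a w IH] x y f g Hf Hg /=.
  have [f0|/Hf] := eqVneq (f [::]) 0; first by rewrite f0 mul0r !mulr0.
  by rewrite excess_nil => <-; rewrite mul0r oppr0 qpow0 mul1r mulrC.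
have Hdf := homog_der (a := a) Hf; have Hdg := homog_der (a := a) Hg.
rewrite (IH (x - lsign b a) y) //.
have -> : (fun u => qpow q^-1 (excess a u) * f u) = (fun u => qpow q (- (lsign b a * x)) * f u).
  apply/funext => u; rewrite qpowV.
  by have [->|/Hf <-] := eqVneq (f u) 0; rewrite ?mulr0 // -excess_lsign.
have -> : (fun u => qpow q (excess a u) * g u) = (fun u => qpow q (lsign b a * y) * g u).
  apply/funext => u.
  by have [->|/Hg <-] := eqVneq (g u) 0; rewrite ?mulr0 // -excess_lsign.
rewrite !starZl (IH x (y - lsign b a)) // addrC [RHS]mulrDr !mulrA -!qpowD //.
by congr (qpow q _ * _ + qpow q _ * _); lia.
Qed.

(** Both algebras consist of functions on words, so their elements can be compared directly.
    Reversed products of homogeneous elements agree only up to a power of $q$, hence proportionality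
    in place of equality. *)
Definition inv_rel (f' : V') (f : V) := exists k, k != 0 /\ forall w, f' w = k * f w.

Lemma inv_rel_refl (f : word -> F) : inv_rel f f.
Proof. by exists 1; split=> [|w]; rewrite ?oner_neq0 ?mul1r. Qed.

Lemma inv_relM b x y (f' g' : V') (f g : V) : homog b x f -> homog b y g ->
  inv_rel f' f -> inv_rel g' g -> inv_rel (f' * g') (g * f).
Proof.
move=> Hf Hg [k [k0 Ef]] [l [l0 Eg]].
exists (k * l * qpow q (- (x * y))); split=> [|w].
  by rewrite !mulf_neq0 ?qpow_neq0.
transitivity (star q^-1 w (fun w => k * f w) (fun w => l * g w)).
  by rewrite -(funext Ef) -(funext Eg).
by rewrite starZl starZr (star_inv _ Hf Hg) -!mulrA.
Qed.

Lemma homog_pr b x (f : nat -> V) s :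
  (forall k, homog b x (f k)) -> homog b (x *+ size s) (pr f s).
Proof.
move=> H; elim: s => [|k s IH]; first by rewrite pr_nil; apply: homog1.
by rewrite pr_cons /= mulrS; apply: homogM.
Qed.

(** Inversion reverses the order of the factors, and commutativity within the family restores it. *)
Lemma inv_pr b x (f' : nat -> V') (f : nat -> V) s :
  (forall k, homog b x (f k)) -> (forall k l, f k * f l = f l * f k) ->
  (forall k, f' k = f k :> (word -> F)) -> inv_rel (pr f' s) (pr f s).
Proof.
move=> Hf fC Ef; elim: s => [|k s IH]; first by rewrite !pr_nil; apply: inv_rel_refl.
rewrite pr_cons -(pr_perm fC (s := rcons s k)) ?perm_rcons // pr_rcons.
apply: (inv_relM (Hf k) (homog_pr Hf)) => //.
by rewrite Ef; apply: inv_rel_refl.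
Qed.
End Inverse.

(** * Independence for two families *)

Section Pairs.
Variables (F : fieldType) (q : F) (hq0 : q != 0).
Local Notation V := (qshuffle hq0).
Local Notation p := (q ^+ 2).
Local Notation O := (@oddalt F q hq0).
Local Notation E := (@evenalt F q hq0).
Local Notation Es := (@evenalt1 F q hq0).

(** In both orders [t.1] indexes the odd words and [t.2] the even ones, so that [eBD] for $1/q$
    matches [eDB] for $q$ index by index. *)
Definition eBD b (t : seq nat * seq nat) : V := pr (O b) t.1 * pr (Es (~~ b)) t.2.
Definition eDB b (t : seq nat * seq nat) : V := pr (Es (~~ b)) t.2 * pr (O b) t.1.

Definition srt2 (t : seq nat * seq nat) := sorted leq t.1 && sorted leq t.2.
Definition deg2 (t : seq nat * seq nat) :=
  (size t.1 + 2 * sumn t.1 + (2 * size t.2 + 2 * sumn t.2))%N.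
Definition srt2d d t := srt2 t && (deg2 t < d)%N.

Lemma indep_deg2 (e : seq nat * seq nat -> word -> F) :
  (forall d, indep (srt2d d) e) <-> indep srt2 e.
Proof.
split=> [H ss c Uss /allP Pss Hc s sss|H d ss c Uss /allP Pss].
  pose d := (\max_(s <- ss) deg2 s).+1%N.
  apply: (H d ss c) => //; apply/allP => t tss; rewrite /srt2d Pss //= ltnS.
  exact: (@leq_bigmax_seq _ ss xpredT deg2).
by apply: H => //; apply/allP => t /Pss /andP[].
Qed.
End Pairs.

Lemma eBD_inv (F : fieldType) (q : F) (hq0 : q != 0) (hqV : q^-1 != 0) b t :
  inv_rel (eBD hqV b t) (eDB hq0 b t).
Proof.
apply: (@inv_relM _ _ _ _ b) => //.
- by apply: homog_pr => k; apply: homog_O.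
- by apply: homog_pr => k; apply: homog_E.
- apply: (@inv_pr _ _ _ _ b 1) => // [k|k l]; [exact: homog_O|exact: O_comm].
- apply: (@inv_pr _ _ _ _ b 0) => // [k|k l]; [exact: homog_E|exact: Es_comm].
Qed.

Lemma not_root_inv (F : fieldType) (q : F) :
  (forall n : nat, (0 < n)%N -> q ^+ n != 1) ->
  forall n : nat, (0 < n)%N -> q^-1 ^+ n != 1.
Proof. by move=> H n /H; rewrite exprVn invr_eq1. Qed.

Section PairStep.
Variables (F : fieldType) (q : F) (hq0 : q != 0).
Hypothesis hq : forall n : nat, (0 < n)%N -> q ^+ n != 1.
Local Notation V := (qshuffle hq0).
Local Notation O := (@oddalt F q hq0).
Local Notation E := (@evenalt F q hq0).
Local Notation Es := (@evenalt1 F q hq0).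
Local Notation T := (seq nat * seq nat)%type.

(** The excess is measured in the letter [b] opposite to the one of the monomial. The left parts are
    then of type [eDB b], all right parts lie in the commuting family [O (~~ b)], and the constant
    depends on sizes only. *)
Lemma eBD_split b : exists k : nat -> nat -> F, (forall m n, k m n != 0) /\
  forall t : T,
  [/\ homog b (- (size t.1)%:Z) (eBD hq0 (~~ b) t),
      forall u v, (size t.2)%:Z < excess b u -> eBD hq0 (~~ b) t (u ++ v) = 0
    & forall u v, excess b u = (size t.2)%:Z ->
      eBD hq0 (~~ b) t (u ++ v) = k (size t.1) (size t.2) *
        \sum_(J <- splits t.1) \sum_(L <- splits t.2)
        (pr (E (~~ b)) J.1 * pr (O b) L.1) u * (pr (O (~~ b)) J.2 * pr (O (~~ b)) L.2) v].
Proof.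
have [c1 [c1n H1]] := top_pr (top_On hq0 b).
have [c2 [c2n H2]] := top_pr (top_Es hq0 b).
exists (fun m n => qpow q (((- 1) *+ m - 0 *+ m) * (1 *+ n)) * (c1 m * c2 n)).
split=> [m n|t]; first by rewrite !mulf_neq0 ?qpow_neq0.
have [T1 T2 T3 _] := topM (H1 t.1) (H2 t.2).
rewrite /eBD negbK; split.
- move: T1; rewrite mul0rn addr0 mulNrn; by rewrite natz.
- by move: T2; rewrite mul0rn add0r natz.
- move=> u v Hu; rewrite T3; last by rewrite mul0rn add0r natz.
  rewrite big_allpairs_dep big_map mulr_sumr; apply: eq_bigr => J _.
  rewrite big_map mulr_sumr; apply: eq_bigr => L _ /=.
  by rewrite scaleE -scalerAl -scalerAr !scaleE !mulrA.
Qed.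

Lemma sort_cat_inj (s t z : seq nat) : sorted leq s -> sorted leq t ->
  sort leq (s ++ z) = sort leq (t ++ z) -> s = t.
Proof.
move=> Ss St E; apply: (sorted_eq leq_trans anti_leq Ss St).
rewrite -(perm_cat2r z) -(perm_sort leq) E perm_sort.
by [].
Qed.

(* In the top component the first tensor factors are monomials of smaller degree
   of type [eDB], independent by induction.  The coefficient at
   [pr (O b) L], for [L] the index of the [Es b] part with maximal size and sum,
   leaves only monomials in [O (~~ b)] as second factors. *)
Lemma indep_pair_step b d :
  indep (srt2d d) (eDB hq0 b) -> indep (srt2d d.+1) (eBD hq0 (~~ b)).
Proof.
move=> HDB ss c Uss /allP Pss H.
have [k [k0 Hk]] := eBD_split b.
apply: (@down_ind _ ss (fun s => size s.2) (fun s => sumn s.2)) => s0 s0s Hs.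
have HO : indep (sorted leq) (pr (O (~~ b))) by apply: indep_O.
have Sss s : s \in ss -> sorted leq s.1 /\ sorted leq s.2.
  by move=> /Pss /andP[/andP[]].
have [Ss01 Ss02] := Sss s0 s0s.
have Hc s : s \in ss -> (size s0.2 < size s.2)%N -> c s = 0.
  by move=> sss lt; apply: Hs => //; rewrite lt.
have Hc2 s : s \in ss -> size s.2 = size s0.2 -> (sumn s0.2 < sumn s.2)%N -> c s = 0.
  by move=> sss e lt; apply: Hs => //; rewrite e eqxx lt orbT.
have [m0|m0] := posnP (size s0.2).
  have R w : \sum_(s <- ss) (if size s.2 == 0%N then c s else 0) * pr (O (~~ b)) s.1 w = 0.
    rewrite -[RHS](H w); apply: eq_big_seq => s sss.
    have [s2|s2] := posnP (size s.2); last by rewrite (Hc s) ?m0 // !mul0r.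
    by rewrite /eBD (size0nil s2) pr_nil mulr1.
  have := indep_coef HO (idx := fst) _ R s0.1.
  rewrite big_mkcond (bigD1_seq s0) //= eqxx m0 /= big1_seq ?addr0.
    by apply=> s /Sss [].
  move=> s /andP[ss0 sss]; case: eqP => // e1; case: eqP => // /size0nil e2.
  by move: ss0; rewrite [s]surjective_pairing [s0]surjective_pairing e1 e2 (size0nil m0) eqxx.
pose m := size s0.2.
pose cc s := (if size s.2 == m then c s else 0) * k (size s.1) (size s.2).
have cc0 s : cc s != 0 -> size s.2 = m.
  by rewrite /cc; case: (size s.2 =P m) => // _; rewrite mul0r eqxx.
pose r := [seq (s, JL) | s <- ss, JL <- [seq (J, L) | J <- splits s.1, L <- splits s.2]].
pose idx (i : T * ((seq nat * seq nat) * (seq nat * seq nat))) : T :=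
  (sort leq i.2.2.1, npos i.2.1.1).
pose cf v (i : T * ((seq nat * seq nat) * (seq nat * seq nat))) :=
  cc i.1 * (pr (O (~~ b)) i.2.1.2 * pr (O (~~ b)) i.2.2.2) v.
have Eidx J L : eDB hq0 b (sort leq L, npos J) = pr (E (~~ b)) J * pr (O b) L.
  by rewrite /eDB pr_npos pr_sort //; apply: O_comm.
have sumr (G : T * ((seq nat * seq nat) * (seq nat * seq nat)) -> F) :
    \sum_(i <- r) G i = \sum_(s <- ss) \sum_(J <- splits s.1) \sum_(L <- splits s.2) G (s, (J, L)).
  rewrite big_allpairs_dep; apply: eq_bigr => s _.
  by rewrite big_allpairs_dep.
have R v u : \sum_(i <- r) cf v i * eDB hq0 b (idx i) u = 0.
  rewrite sumr; have [eu|eu] := eqVneq (excess b u) m%:Z; last first.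
    rewrite big1_seq // => s _; have [c0|/cc0 e2] := eqVneq (cc s) 0.
      by rewrite big1 // => J _; rewrite big1 // => L _; rewrite /cf c0 !mul0r.
    rewrite big1_seq // => J _; rewrite big1_seq // => L /andP[_ /splitsP[e3 _ _]].
    rewrite Eidx; have [->|] := eqVneq ((pr (E (~~ b)) J.1 * pr (O b) L.1) u) 0.
      by rewrite mulr0.
    have Ho : homog b (0 *+ size J.1 + 1 *+ size L.1) (pr (E (~~ b)) J.1 * pr (O b) L.1).
      by apply: homogM; apply: homog_pr => i; [apply: homog_E|apply: homog_O].
    by move=> /Ho; rewrite mul0rn add0r natz e3 e2 => eu'; rewrite eu' eqxx in eu.
  rewrite -[RHS](H (u ++ v)); apply: eq_big_seq => s sss.
  have [_ Hv Hs'] := Hk s.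
  case: (ltngtP (size s.2) m) => sm.
  - rewrite Hv ?eu ?ltz_nat // mulr0 big1 // => J _; rewrite big1 // => L _.
    by rewrite /cf /cc ltn_eqF // !mul0r.
  - rewrite Hc // mul0r big1 // => J _; rewrite big1 // => L _.
    by rewrite /cf /cc gtn_eqF // !mul0r.
  rewrite Hs' ?eu ?sm // mulrA mulr_sumr; apply: eq_bigr => J _.
  rewrite mulr_sumr; apply: eq_bigr => L _.
  by rewrite Eidx /cf /cc sm eqxx /= -!mulrA; congr (_ * (_ * _)); apply: mulrC.
(* The degree drops by at least [m], since each of the [m] even factors leaves an odd word on the
   right. *)
have Pr v i : i \in r -> cf v i != 0 -> srt2d d (idx i).
  move=> /allpairsPdep[s [[J L] [sss /allpairsPdep[J' [L' [HJ HL [-> ->]]]] ->]]].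
  rewrite /cf mulf_eq0 negb_or => /andP[/cc0 sm _].
  rewrite /srt2d /srt2 /= npos_sorted (sort_sorted leq_total) /=.
  have /andP[_] := Pss s sss; rewrite /deg2 /=.
  have [h1 h2 h3] := splitsP HJ; have [g1 g2 g3] := splitsP HL.
  have -> : sumn (sort leq L'.1) = sumn L'.1 by apply: perm_sumn; rewrite perm_sort.
  rewrite size_sort; move: m0 (size_sumn_npos J'.1) h1 h2 h3 g1 g2 g3 sm; rewrite -/m.
  move: (size (npos _)) (sumn (npos _)) (size J'.1) (size J'.2) (sumn J'.1) (sumn J'.2)
    (size L'.1) (size L'.2) (sumn L'.1) (sumn L'.2) (size s.1) (size s.2) (sumn s.1) (sumn s.2).
  by clear; lia.
(* The empty list forces [J.1] to be zero, so [s.1] passes entirely to the right. Since [sumn s0.2]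
   is maximal, [L.2] is zero and the even factors contribute just [m] letters, the appended zeros
   below. *)
have {R Pr} R v := indep_coef HDB (Pr v) (R v) (s0.2, [::]).
pose c' s := if s.2 == s0.2 then cc s else 0.
have {}R v : \sum_(s <- ss) c' s * pr (O (~~ b)) (sort leq (s.1 ++ nseq m 0%N)) v = 0.
  rewrite -[RHS](R v) [RHS]big_mkcond sumr; apply: eq_big_seq => s sss.
  have [c0|/[dup] c0 /cc0 sm] := eqVneq (cc s) 0.
    rewrite /c' c0 if_same mul0r big1 // => J _; rewrite big1 // => L _.
    by rewrite /cf c0 mul0r if_same.
  have HL : (sumn s.2 <= sumn s0.2)%N.
    rewrite leqNgt; apply: contra_neqN c0 => lt.
    by rewrite /cc sm eqxx Hc2 // mul0r.
  transitivity (\sum_(J <- splits s.1 | sumn J.1 == 0%N)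
      \sum_(L <- splits s.2 | sumn L.2 == 0%N)
      (if sort leq L.1 == s0.2 then cf v (s, (J, L)) else 0)).
    rewrite big_splits_l big_splits_r /c' /cf /=.
    have [_ Ss2] := Sss s sss; rewrite (sorted_sort leq_trans Ss2); case: eqP => _; last by rewrite mul0r.
    by rewrite (pr_sort _ (O_comm hq0 (~~ b))) pr_cat sm.
  rewrite [LHS]big_mkcond; apply: eq_bigr => J _.
  case: ifP => J0; last first.
    by rewrite big1 // => L _; rewrite /idx /= xpair_eqE npos_nil J0 andbF.
  rewrite [LHS]big_mkcond; apply: eq_big_seq => L LL.
  rewrite /idx /= xpair_eqE npos_nil J0 andbT; case: ifP => // L0.
  case: eqP => // eL; case/eqP: L0.
  have [g1 g2 g3] := splitsP LL; move: HL; rewrite -eL -g3.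
  have -> : sumn (sort leq L.1) = sumn L.1 by apply: perm_sumn; rewrite perm_sort.
  by rewrite -{2}[sumn L.1]addn0 leq_add2l leqn0 => /eqP.
have := indep_coef HO (idx := fun s => sort leq (s.1 ++ nseq m 0%N)) _ R
  (sort leq (s0.1 ++ nseq m 0%N)).
rewrite big_mkcond (bigD1_seq s0) //= eqxx big1_seq ?addr0.
  move=> H0; have : c' s0 = 0 by apply: H0 => s _ _; apply: sort_sorted leq_total _.
  by rewrite /c' /cc !eqxx => /eqP; rewrite mulf_eq0 (negPf (k0 _ _)) orbF => /eqP.
move=> s /andP[ss0 sss]; case: eqP => // /sort_cat_inj e1; rewrite /c'; case: eqP => // e2.
have [Ss1 _] := Sss s sss.
by move: ss0; rewrite [s]surjective_pairing [s0]surjective_pairing e1 // e2 eqxx.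
Qed.

End PairStep.

(** The pair step reduces [eBD b] to [eDB (~~ b)] in smaller degree, which is [eBD (~~ b)] for $1/q$
    up to scalars; hence the induction generalizes [q] and [b]. *)
Lemma indep_eBD (F : fieldType) (q : F) (hq0 : q != 0) b :
  (forall n : nat, (0 < n)%N -> q ^+ n != 1) -> indep srt2 (eBD hq0 b).
Proof.
move=> hq; apply/indep_deg2 => d; elim: d => [|d IH] in q hq0 hq b *.
  by move=> ss c _ /allP H _ s /H; rewrite /srt2d ltn0 andbF.
rewrite -[b]negbK; apply: indep_pair_step => //.
have hqV0 : q^-1 != 0 by rewrite invr_neq0.
apply: indep_scale (IH _ hqV0 (not_root_inv hq) (~~ b)) _ => t.
have [k [k0 H]] := eBD_inv hq0 hqV0 (~~ b) t.
by exists k^-1; split=> [|w]; [rewrite invr_neq0|rewrite H mulKf].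
Qed.

Lemma indep_eDB (F : fieldType) (q : F) (hq0 : q != 0) b :
  (forall n : nat, (0 < n)%N -> q ^+ n != 1) -> indep srt2 (eDB hq0 b).
Proof.
move=> hq; have hqV0 : q^-1 != 0 by rewrite invr_neq0.
have HI : indep srt2 (eBD hqV0 b) by apply/indep_eBD/not_root_inv.
apply: (indep_scale HI) => t.
have [k [k0 H]] := eBD_inv hq0 hqV0 b t.
by exists k^-1; split=> [|w]; [rewrite invr_neq0|rewrite H mulKf].
Qed.

(** * Independence for three families *)

Section Triples.
Variables (F : fieldType) (q : F) (hq0 : q != 0).
Hypothesis hq : forall n : nat, (0 < n)%N -> q ^+ n != 1.
Local Notation V := (qshuffle hq0).
Local Notation O := (@oddalt F q hq0).
Local Notation E := (@evenalt F q hq0).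
Local Notation Es := (@evenalt1 F q hq0).
Local Notation T := (seq nat * seq nat)%type.

Lemma rv_pr (f f' : nat -> V) s : (forall k, rv (f k) = f' k) ->
  (forall k l, f' k * f' l = f' l * f' k) -> rv (pr f s) = pr f' s.
Proof.
move=> Ef fC; rewrite /pr rv_prod; under eq_bigr => k _ do rewrite Ef.
by apply: (pr_perm fC); rewrite perm_rev.
Qed.

Definition eDC b (t : T) : V := pr (Es (~~ b)) t.2 * pr (O (~~ b)) t.1.

Lemma indep_rv (I : eqType) (P : pred I) (e e' : I -> V) :
  (forall t, rv (e t) = e' t) -> indep P e -> indep P e'.
Proof.
move=> Ee He ss c Uss Pss H; apply: (He ss c) => // w.
rewrite -[RHS](H (rev w)); apply: eq_bigr => s _.
by rewrite -Ee /rv revK.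
Qed.

Lemma rv_eBD b t : rv (eBD hq0 (~~ b) t) = eDC b t.
Proof.
rewrite /eBD rvM negbK.
rewrite (rv_pr _ (fun k => rv_O hq0 (~~ b) k)) ?(@rv_pr (Es b) (Es (~~ b))) //.
- by move=> k; rewrite /Es rv_E.
- exact: Es_comm.
- exact: O_comm.
Qed.

Lemma indep_eDC b : indep srt2 (eDC b).
Proof. by apply: (indep_rv (rv_eBD b)); apply: indep_eBD. Qed.

(* The part of the top component whose second tensor factor is a scalar is a
   multiple of [f] itself; the other second factors are nontrivial products. *)
Definition scalar_top b (x : int) (f : V) := exists (r : seq (V * seq nat)) (k : F),
  [/\ k != 0, top b x x f [seq (i.1, pr (E (~~ b)) i.2) | i <- r]
    & \sum_(i <- r | sumn i.2 == 0%N) i.1 = k *: f].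

(** All right parts have excess 0, so no twist appears in the product of the two monomials. The
    right part is a scalar exactly for the splitting with all right indices zero, whose left part is
    the whole monomial. *)
Lemma scalar_topM b x y (f g : nat -> V) K L :
  fam_top b x x f f (E (~~ b)) -> fam_top b y y g g (E (~~ b)) ->
  scalar_top b (x *+ size K + y *+ size L) (pr f K * pr g L).
Proof.
move=> /top_pr[c1 [c10 H1]] /top_pr[c2 [c20 H2]].
have := topM (H1 K) (H2 L); rewrite subrr mul0r qpow0.
rewrite allpairs_mapl allpairs_mapr /= => Ht.
exists [seq (c1 (size K) *: pr f J.1 * (c2 (size L) *: pr g J'.1), J.2 ++ J'.2)
  | J <- splits K, J' <- splits L].
exists (c1 (size K) * c2 (size L)); split; first by rewrite mulf_neq0.
  move: Ht; congr top; rewrite map_allpairs; apply: eq_allpairs => J J' /=.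
  by rewrite scale1r pr_cat.
rewrite big_mkcond big_allpairs_dep /=.
transitivity (\sum_(J <- splits K | sumn J.2 == 0%N) \sum_(J' <- splits L | sumn J'.2 == 0%N)
   (c1 (size K) *: pr f J.1 * (c2 (size L) *: pr g J'.1))).
  rewrite [RHS]big_mkcond; apply: eq_bigr => J _; case: ifP => J0; last first.
    by rewrite big1 // => J' _; rewrite sumn_cat addn_eq0 J0.
  rewrite [RHS]big_mkcond; apply: eq_bigr => J' _.
  by rewrite sumn_cat addn_eq0 J0.
by rewrite !big_splits_r /= -scalerAl -scalerAr scalerA.
Qed.

Lemma scalar_top_BD b t : scalar_top b (size t.1)%:Z (eBD hq0 b t).
Proof.
have := scalar_topM t.1 (map succn t.2) (top_O hq0 b) (top_E hq0 b).
by rewrite mul0rn addr0 natz /eBD /pr big_map.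
Qed.

Lemma scalar_top_DB b t : scalar_top b (size t.1)%:Z (eDB hq0 b t).
Proof.
have := scalar_topM (map succn t.2) t.1 (top_E hq0 b) (top_O hq0 b).
by rewrite mul0rn add0r natz /eDB /pr big_map.
Qed.

Definition srt3 (t : T * seq nat) := srt2 t.1 && sorted leq t.2.

(* In the top component the second tensor factors are independent monomials in
   [Es (~~ b)] and [O (~~ b)]; the coefficient at [pr (O (~~ b)) M], with [sumn M]
   maximal, recovers a relation between the [X t]. *)
Lemma indep_triple b (X : T -> V) :
  (forall t, scalar_top b (size t.1)%:Z (X t)) -> indep srt2 X ->
  indep srt3 (fun t => X t.1 * pr (O (~~ b)) t.2).
Proof.
move=> /choice [r /choice [k HX]] iX.
have [c2 [c20 HC]] := top_pr (top_On hq0 b).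
move=> ss c Uss /allP Pss H.
apply: (@down_ind _ ss (fun s => size s.1.1) (fun s => sumn s.2)) => s0 s0s Hs.
have Sss s : s \in ss -> srt2 s.1 /\ sorted leq s.2 by move=> /Pss /andP[].
have Hc s : s \in ss -> (size s0.1.1 < size s.1.1)%N -> c s = 0.
  by move=> sss lt; apply: Hs => //; rewrite lt.
have Hc2 s : s \in ss -> size s.1.1 = size s0.1.1 -> (sumn s0.2 < sumn s.2)%N -> c s = 0.
  by move=> sss e lt; apply: Hs => //; rewrite e eqxx lt orbT.
pose n := size s0.1.1.
pose cc (s : T * seq nat) := (if size s.1.1 == n then c s else 0) * c2 (size s.2).
have cc0 s : cc s != 0 -> size s.1.1 = n.
  by rewrite /cc; case: (size s.1.1 =P n) => // _; rewrite mul0r eqxx.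
pose Ix := ((T * seq nat) * ((V * seq nat) * (seq nat * seq nat)))%type.
pose R : seq Ix := [seq (s, iJ) | s <- ss, iJ <- [seq (i, J) | i <- r s.1, J <- splits s.2]].
pose idx (i : Ix) : T := (sort leq i.2.2.2, npos i.2.1.2).
pose cf u (i : Ix) := cc i.1 * (i.2.1.1 * pr (E (~~ b)) i.2.2.1) u.
have sumR (G : Ix -> F) : \sum_(i <- R) G i =
    \sum_(s <- ss) \sum_(i <- r s.1) \sum_(J <- splits s.2) G (s, (i, J)).
  by rewrite big_allpairs_dep; apply: eq_bigr => s _; rewrite big_allpairs_dep.
have H1 u v : excess b u = n%:Z -> \sum_(i <- R) cf u i * eDC b (idx i) v = 0.
  move=> eu; rewrite sumR -[RHS](H (u ++ v)); apply: eq_big_seq => s sss.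
  have [_ tX _] := HX s.1; have [_ Tv Ts _] := topM tX (HC s.2).
  have e2 : (size s.1.1)%:Z + 0 *+ size s.2 = (size s.1.1)%:Z by rewrite mul0rn addr0.
  case: (ltngtP (size s.1.1) n) => sm.
  - rewrite Tv ?e2 ?eu ?ltz_nat // mulr0 big1 // => J _; rewrite big1 // => L _.
    by rewrite /cf /cc ltn_eqF // !mul0r.
  - rewrite Hc // mul0r big1 // => J _; rewrite big1 // => L _.
    by rewrite /cf /cc gtn_eqF // !mul0r.
  rewrite Ts ?e2 ?eu ?sm // big_allpairs_dep big_map mulr_sumr; apply: eq_bigr => i _.
  rewrite big_map mulr_sumr; apply: eq_bigr => J _ /=.
  rewrite mul0rn mulr0 qpow0 scale1r -scalerAr scaleE /cf /cc sm eqxx /= -!mulrA.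
  congr (_ * (_ * (_ * _))).
  by rewrite /eDC pr_npos pr_sort //; apply: O_comm.
have P1 u i : i \in R -> cf u i != 0 -> srt2 (idx i).
  by move=> _ _; rewrite /srt2 /= npos_sorted (sort_sorted leq_total).
(* At this index the $D$ component is empty, which selects the scalar part of [X]; maximality of
   [sumn s0.2] then forces the left indices of the $C$ factors to be zero. *)
have H2 u : excess b u = n%:Z -> \sum_(i <- R | idx i == (s0.2, [::])) cf u i = 0.
  have iDC : indep srt2 (eDC b) by apply: indep_eDC.
  by move=> eu; apply: (indep_coef iDC (P1 u)) => v; apply: H1.
pose c' s := (if s.2 == s0.2 then cc s * k s.1 else 0).
(* At words of any other excess every term vanishes by homogeneity of [X]. *)
have {}H2 u : \sum_(s <- ss) c' s * X s.1 u = 0.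
  have [eu|eu] := eqVneq (excess b u) n%:Z; last first.
    rewrite big1_seq // => s /andP[_ sss].
    have [->|Xu] := eqVneq (X s.1 u) 0; first by rewrite mulr0.
    have [_ [Ho _ _ _] _] := HX s.1.
    rewrite /c' /cc; case: eqP => _; last by rewrite mul0r.
    by case: eqP => [e|_]; [move: eu; rewrite (Ho _ Xu) e eqxx|rewrite !mul0r].
  rewrite -[RHS](H2 u eu) [RHS]big_mkcond sumR; apply: eq_big_seq => s sss.
  have [c0|/[dup] c0 /cc0 sm] := eqVneq (cc s) 0.
    rewrite /c' c0 mul0r if_same mul0r big1 // => J _; rewrite big1 // => L _.
    by rewrite /cf c0 mul0r if_same.
  have HL : (sumn s.2 <= sumn s0.2)%N.
    rewrite leqNgt; apply: contra_neqN c0 => lt.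
    by rewrite /cc sm eqxx Hc2 // mul0r.
  transitivity (\sum_(i <- r s.1 | sumn i.2 == 0%N)
      \sum_(J <- splits s.2 | sumn J.1 == 0%N)
      (if sort leq J.2 == s0.2 then cf u (s, (i, J)) else 0)).
    under eq_bigr => i _ do rewrite big_splits_l.
    have [_ Ss2] := Sss s sss; rewrite /c' /= (sorted_sort leq_trans Ss2).
    case: eqP => _; last by rewrite mul0r big1.
    rewrite /cf /=; under eq_bigr => i _ do rewrite pr_nseq E0 expr1n mulr1.
    have [_ _ Xs] := HX s.1.
    by rewrite -mulr_sumr -mulrA -scaleE -Xs sumE.
  rewrite [LHS]big_mkcond; apply: eq_bigr => J _.
  case: ifP => J0; last first.
    by rewrite big1 // => L _; rewrite /idx /= xpair_eqE npos_nil J0 andbF.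
  rewrite [LHS]big_mkcond; apply: eq_big_seq => L LL.
  rewrite /idx /= xpair_eqE npos_nil J0 andbT; case: ifP => // L0.
  case: eqP => // eL; case/eqP: L0.
  have [g1 g2 g3] := splitsP LL; move: HL; rewrite -eL -g3.
  have -> : sumn (sort leq L.2) = sumn L.2 by apply: perm_sumn; rewrite perm_sort.
  by rewrite -{2}[sumn L.2]add0n leq_add2r leqn0 => /eqP.
have P2 i : i \in ss -> c' i != 0 -> srt2 i.1 by move=> /Sss[].
have := indep_coef iX P2 H2 s0.1.
rewrite big_mkcond (bigD1_seq s0) //= eqxx big1_seq ?addr0.
  rewrite /c' /cc !eqxx => /eqP; rewrite !mulf_eq0 (negPf (c20 _)) orbF.
  by have [/negPf -> _ _] := HX s0.1; rewrite orbF => /eqP.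
move=> s /andP[ss0 sss]; case: eqP => // e1; rewrite /c'; case: eqP => // e2.
by move: ss0; rewrite [s]surjective_pairing [s0]surjective_pairing e1 e2 eqxx.
Qed.

End Triples.

(** * Formal combinations and the six orders *)

Section Combinations.
Variables (F : fieldType) (q : F) (hq0 : q != 0).
Local Notation V := (qshuffle hq0).
Local Notation ind := (@ind F q hq0).

Lemma vecE (L : lc F) : vec L = \sum_(a <- L) a.1 *: ind a.2 :> V.
Proof.
apply/funext => w; rewrite sumE; apply: eq_bigr => a _.
by rewrite scaleE /ind eq_sym; case: eqP; rewrite ?mulr1 ?mulr0.
Qed.

Lemma vec_cat (L M : lc F) : vec (L ++ M) = (vec L : V) + (vec M : V) :> V.
Proof. by rewrite !vecE big_cat. Qed.

Lemma der_vec_cons c a k (L : lc F) :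
  der c (vec [seq (r.1 * k, a :: r.2) | r <- L] : V) = if c == a then k *: (vec L : V) else 0.
Proof.
rewrite !vecE big_map /=; elim: L => [|r L IH]; first by rewrite !big_nil scaler0 if_same.
rewrite !big_cons derD IH derZ der_ind; case: eqP => _; last by rewrite scaler0 add0r.
by rewrite scalerDr scalerA mulrC.
Qed.

Lemma vec_cons_nil a k (L : lc F) :
  (vec [seq (r.1 * k, a :: r.2) | r <- L] : V) [::] = 0.
Proof. by rewrite vecE big_map sumE big1 // => r _; rewrite scaleE mulr0. Qed.

Lemma bform_sum b u : q ^ (\sum_(c <- u) bform c b) = qpow q (excess b u).
Proof.
rewrite /qpow [q ^+ 2]exprnP exprz_exp; congr (_ ^ _).
rewrite /excess big_distrr /=; apply: eq_bigr => c _.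
by rewrite /bform; case: eqP.
Qed.

(** Both sides have the same derivations; the inner induction on [v] follows the nested fixpoint of
    [shw]. *)
Lemma vec_shw u v : vec (shw q u v) = ind u * ind v :> V.
Proof.
elim: u v => [|a u IHu] v.
  by rewrite ind0 mul1r vecE big_seq1 scale1r.
elim: v => [|b v IHv].
  by rewrite ind0 mulr1 vecE big_seq1 scale1r.
rewrite [shw _ _ _]/= -/(shw q (a :: u)).
have -> : [seq (r.1, a :: r.2) | r <- shw q u (b :: v)]
   = [seq (r.1 * 1, a :: r.2) | r <- shw q u (b :: v)].
  by apply: eq_map => r; rewrite mulr1.
rewrite vec_cat; apply: der_ext => [|c].
  by rewrite addE !vec_cons_nil mul_nil mul0r addr0.
rewrite derD !der_vec_cons derM !der_ind scale1r IHu bform_sum.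
have Etw : tw c (ind (a :: u)) = qpow q (excess c (a :: u)) *: ind (a :: u).
  have Hh : homog c (excess c (a :: u)) (ind (a :: u)) by apply: homog_ind.
  rewrite (tw_homog c Hh).
  by rewrite /lsign eqxx mul1r.
congr (_ + _); first by case: eqP; rewrite ?mul0r.
case: eqP => [<-|_]; last by rewrite mulr0.
rewrite Etw -scalerAl; congr (_ *: _).
exact: IHv.
Qed.

Lemma vec_lstar (L M : lc F) : vec (lstar q L M) = (vec L : V) * (vec M : V) :> V.
Proof.
rewrite !vecE /lstar big_flatten /= big_allpairs_dep mulr_suml.
apply: eq_bigr => a _; rewrite mulr_sumr; apply: eq_bigr => b _.
rewrite big_map /= -scalerAl -scalerAr scalerA -vec_shw vecE scaler_sumr.
by apply: eq_bigr => c _; rewrite scalerA.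
Qed.

Lemma vec_lprod Ls : vec (lprod q Ls) = \prod_(L <- Ls) (vec L : V) :> V.
Proof.
elim: Ls => [|L Ls IH]; last by rewrite big_cons -IH -vec_lstar.
by rewrite big_nil vecE big_seq1 scale1r ind0.
Qed.

Lemma vec_word w : vec [:: (1, w)] = ind w :> V.
Proof. by rewrite vecE big_seq1 scale1r. Qed.

Lemma vec_gmono g : vec (gmono q g) = \prod_(c <- g) oddalt hq0 c 0 :> V.
Proof. by rewrite vec_lprod big_map; apply: eq_bigr => c _; rewrite vec_word /oddalt /altw alt_cons. Qed.

Lemma vec_omono s : vec (omono q s) = \prod_(a <- s) ind (Omega_word a) :> V.
Proof. by rewrite vec_lprod big_map; apply: eq_bigr => c _; rewrite vec_word. Qed.

Lemma inU_U (f : word -> F) : inU q f <-> @Ualg F q hq0 f.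
Proof.
split=> [[ts ->]|].
  rewrite (_ : (fun w => _) = \sum_(t <- ts) t.1 *: (\prod_(c <- t.2) oddalt hq0 c 0)).
    by apply: span_sum => t _; apply: spanZ; apply: span_gen; exists t.2.
  by apply/funext => w; rewrite sumE; apply: eq_bigr => t _; rewrite scaleE -vec_gmono.
apply; first split.
- by exists [::]; apply/funext => w; rewrite big_nil.
- move=> c _ _ [ts1 ->] [ts2 ->].
  exists ([seq (c * t.1, t.2) | t <- ts1] ++ ts2); apply/funext => w.
  rewrite big_cat big_map /= addE scaleE mulr_sumr; congr (_ + _).
  by apply: eq_bigr => t _; rewrite mulrA.
move=> _ [g ->]; exists [:: (1, g)]; apply/funext => w.
by rewrite big_seq1 mul1r -vec_gmono.
Qed.
End Combinations.

Notation triple := (seq nat * seq nat * seq nat)%type.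

(** * Bases of $U$ indexed by exponent triples *)

Section Basis.
Variables (F : fieldType) (q : F) (hq0 : q != 0).
Hypothesis hq : forall n : nat, (0 < n)%N -> q ^+ n != 1.
Local Notation V := (qshuffle hq0).
Local Notation O := (@oddalt F q hq0).
Local Notation E := (@evenalt F q hq0).
Local Notation Es := (@evenalt1 F q hq0).
Local Notation Ualg := (@Ualg F q hq0).

Definition basis (e : triple -> V) :=
  [/\ forall t, Ualg (e t), indep srt3 e
    & forall f, Ualg f -> Span (fun h => exists t, srt3 t /\ h = e t) f].

Definition eBDC b (t : triple) : V := eBD hq0 b t.1 * pr (O (~~ b)) t.2.
Definition eDBC b (t : triple) : V := eDB hq0 b t.1 * pr (O (~~ b)) t.2.

Lemma U_prO b s : Ualg (pr (O b) s).
Proof. by apply: U_pr => k; apply: U_O. Qed.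
Lemma U_prEs b s : Ualg (pr (Es b) s).
Proof. by apply: U_pr => k; apply: U_E. Qed.

Lemma basis_BDC b : basis (eBDC b).
Proof.
split=> [t||f /(Ualg_tri_span (b := b))].
- by apply: UM; [apply: UM|]; [apply: U_prO|apply: U_prEs|apply: U_prO].
- by apply: indep_triple => // [t|]; [apply: scalar_top_BD|apply: indep_eBD].
apply: span_sub => _ [_ [_ [[_ [_ [[s ->] [t ->] ->]]] [u ->] ->]]].
apply: span_gen; exists (sort leq s, npos t, sort leq u).
rewrite /srt3 /srt2 /= npos_sorted !(sort_sorted leq_total); split=> //.
by rewrite /eBDC /eBD /= pr_npos !pr_sort //; apply: O_comm.
Qed.

Lemma basis_DBC b : basis (eDBC b).
Proof.
split=> [t||f /(Ualg_tri_span_swap (b := b))].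
- by apply: UM; [apply: UM|]; [apply: U_prEs|apply: U_prO|apply: U_prO].
- by apply: indep_triple => // [t|]; [apply: scalar_top_DB|apply: indep_eDB].
apply: span_sub => _ [_ [_ [[_ [_ [[t ->] [s ->] ->]]] [u ->] ->]]].
apply: span_gen; exists (sort leq s, npos t, sort leq u).
rewrite /srt3 /srt2 /= npos_sorted !(sort_sorted leq_total); split=> //.
by rewrite /eDBC /eDB /= pr_npos !pr_sort //; apply: O_comm.
Qed.

Lemma U_rv f : Ualg f -> Ualg (rv f).
Proof.
move=> Uf; apply: (Uf (fun f => Ualg (rv f))); first split.
- exact: span0.
- by move=> c g h Ug Uh; rewrite rvD rvZ; apply: spanD => //; apply: spanZ.
move=> _ [g ->]; rewrite rv_prod; apply: span_gen; exists (rev g).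
by apply: eq_bigr => c _; rewrite rv_O.
Qed.

Lemma basis_rv e e' : (forall t, rv (e t) = e' t) -> basis e -> basis e'.
Proof.
move=> Ee [H1 H2 H3]; split=> [t||f /U_rv/H3 Hf].
- by rewrite -Ee; apply: U_rv.
- exact: indep_rv Ee H2.
rewrite -[f]rvK; apply: (Hf (fun f => Span _ (rv f))); first split.
- exact: span0.
- by move=> c g h Ug Uh; rewrite rvD rvZ; apply: spanD => //; apply: spanZ.
by move=> _ [t [St ->]]; apply: span_gen; exists t; rewrite Ee.
Qed.

(** Exchanging $x$ and $y$ exchanges the two odd families; this relabels the exponents
    accordingly. *)
Lemma basis_swap e : basis e -> basis (fun t => e (t.2, t.1.2, t.1.1)).
Proof.
have Hs t : srt3 t -> srt3 (t.2, t.1.2, t.1.1).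
  by case: t => [[K L] M]; rewrite /srt3 /srt2 /= => /andP[/andP[-> ->] ->].
move=> [H1 H2 H3]; split=> [//||f /H3].
  move=> ss c Uss /allP Pss H s sss.
  have := indep_coef H2 (r := ss) (c := c) (idx := fun t => (t.2, t.1.2, t.1.1)) _ H
    (s.2, s.1.2, s.1.1).
  rewrite big_mkcond (bigD1_seq s) //= eqxx big1_seq ?addr0.
    by apply=> t /Pss /Hs.
  move=> [[K L] M] /andP[ts _]; case: eqP => //= -[e1 e2 e3].
  by case/eqP: ts; case: s e1 e2 e3 {sss} => [[K' L'] M'] /= -> -> ->.
apply: span_sub => _ [t [St ->]]; apply: span_gen; exists (t.2, t.1.2, t.1.1).
by split; [apply: Hs|case: t {St} => [[K L] M]].
Qed.
End Basis.

(** A product of letters for $1/q$ is a scalar multiple of the reversed product for $q$, so $U$ is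
    the same set of functions for both. *)
Lemma U_inv (F : fieldType) (q : F) (hq0 : q != 0) (hqV : q^-1 != 0) (f : word -> F) :
  @Ualg F q^-1 hqV f -> @Ualg F q hq0 f.
Proof.
apply; first split.
- exact: (@span0 _ (qshuffle hq0)).
- by move=> c g h Ug Uh; apply: (@spanD _ (qshuffle hq0)) => //; apply: (@spanZ _ (qshuffle hq0)).
move=> _ [g ->].
suff [k [k0 H]] : inv_rel (\prod_(c <- g) oddalt hqV c 0) (\prod_(c <- rev g) oddalt hq0 c 0).
  rewrite (_ : \prod_(c <- g) oddalt hqV c 0 = k *: (\prod_(c <- rev g) oddalt hq0 c 0) :> (word -> F)).
    by apply: (@spanZ _ (qshuffle hq0)); apply: span_gen; exists (rev g).
  by apply/funext => w; rewrite H.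
elim: g => [|c g IH]; first by rewrite !big_nil; apply: (inv_rel_refl hq0 hqV).
rewrite big_cons rev_cons -cats1 big_cat big_seq1 /=.
apply: (@inv_relM _ _ _ _ c 1 (\sum_(d <- rev g) lsign c d)) => //.
- exact: homog_O.
- apply: homog_prod => d; rewrite /lsign; case: eqP => [->|/eqP]; first exact: homog_O.
  by rewrite eq_sym => /neq_negb ->; apply: homog_On.
- exact: inv_rel_refl.
Qed.

Lemma basis_inv (F : fieldType) (q : F) (hq0 : q != 0) (hqV : q^-1 != 0)
    (e' : triple -> qshuffle hqV) (e : triple -> qshuffle hq0) :
  (forall t, inv_rel (e' t) (e t)) -> basis e' -> basis e.
Proof.
move=> He [H1 H2 H3].
have He' t : exists k, k != 0 /\ forall w, e t w = k * e' t w.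
  have [k [k0 Hk]] := He t.
  by exists k^-1; split=> [|w]; [rewrite invr_neq0|rewrite Hk mulKf].
split=> [t||f Uf].
- have [k [k0 Hk]] := He' t.
  have -> : e t = k *: (e' t : qshuffle hq0) by apply/funext.
  by apply: spanZ; apply: U_inv (H1 t).
- exact: indep_scale H2 He'.
(* The converse inclusion is [U_inv] applied to $1/q$, whose inverse is $q$; the two proofs that
   $q\ne0$ are identified by irrelevance. *)
have hqK : q^-1^-1 != 0 by rewrite invrK.
have : @Ualg F q^-1 hqV f.
  apply: (@U_inv F q^-1 hqV hqK); move: hqK; rewrite invrK => hqK.
  by rewrite (bool_irrelevance hqK hq0).
move/H3; apply; first split.
- exact: (@span0 _ (qshuffle hq0)).
- by move=> c g h Ug Uh; apply: (@spanD _ (qshuffle hq0)) => //; apply: (@spanZ _ (qshuffle hq0)).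
move=> _ [t [St ->]]; have [k [k0 Hk]] := He t.
have -> : (e' t : word -> F) = k *: (e t : qshuffle hq0) by apply/funext.
by apply: spanZ; apply: span_gen; exists t.
Qed.

(** * Nondecreasing lists in $\Omega$ and exponent triples *)

Definition Om_val (a : Omega) : nat :=
  match a with Om_Wm i => i | Om_G i => i | Om_Wp i => i end.

Definition Om_cls (a : Omega) : nat :=
  match a with Om_Wm _ => 0 | Om_G _ => 1 | Om_Wp _ => 2 end.

Definition part (i : nat) (s : seq Omega) : seq nat :=
  [seq Om_val a | a <- s & Om_cls a == i].

(** The given order is arbitrary inside each family; sorting by index forgets it, and the monomial
    is unchanged because each family commutes. *)
Definition exponents (s : seq Omega) : triple :=
  (sort leq (part 0 s), sort leq (part 1 s), sort leq (part 2 s)).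

Definition of_exponents (t : triple) : seq Omega :=
  [seq Om_Wm i | i <- t.1.1] ++ [seq Om_G i | i <- t.1.2] ++ [seq Om_Wp i | i <- t.2].

Lemma perm_of_exponents s : perm_eq s (of_exponents (part 0 s, part 1 s, part 2 s)).
Proof.
elim: s => [//|a s IH]; rewrite /of_exponents /part /= in IH *.
case: a => i /=; first by rewrite perm_cons.
  by rewrite perm_sym -cat1s perm_catCA /= perm_cons perm_sym.
rewrite perm_sym catA -cat1s perm_catCA /= perm_cons perm_sym.
by rewrite -catA.
Qed.

Lemma part_of_exponents i t : part i (of_exponents t) =
  if i is 0 then t.1.1 else if i is 1 then t.1.2 else if i is 2 then t.2 else [::].
Proof.
rewrite /part /of_exponents !filter_cat !map_cat.
have H j (c : nat -> Omega) (s : seq nat) : (forall k, Om_cls (c k) = j) ->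
    (forall k, Om_val (c k) = k) ->
    [seq Om_val a | a <- [seq c k | k <- s] & Om_cls a == i] = if j == i then s else [::].
  move=> H1 H2; elim: s => [|k s IH] /=; first by rewrite if_same.
  by rewrite H1; case: eqP IH => //= _ ->; rewrite H2.
rewrite (H 0 Om_Wm) // (H 1 Om_G) // (H 2 Om_Wp) //.
by case: i H => [|[|[|i]]] _ //=; rewrite ?cats0.
Qed.

Section Order.
Variable lt : Omega -> Omega -> Prop.
Hypothesis Hlin : strict_linear_order lt.

Definition leO (a b : Omega) : bool := `[< lt a b \/ a = b >].

Lemma leO_total : total leO.
Proof.
case: Hlin => _ _ H a b; rewrite /leO; have [->|/eqP ab] := eqVneq a b.
  by rewrite (asboolT (or_intror erefl)).
by case: (H _ _ ab) => h; apply/orP; [left|right]; apply/asboolP; left.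
Qed.

Lemma leO_trans : transitive leO.
Proof.
case: Hlin => _ H _ b a c /asboolP[ab|->] /asboolP[bc|<-]; apply/asboolP; auto.
by left; apply: H bc.
Qed.

Lemma leO_anti : antisymmetric leO.
Proof.
case: Hlin => Hi Ht _ a b /andP[/asboolP[ab|//] /asboolP[ba|//]].
by case: (Hi a); apply: Ht ba.
Qed.

Lemma nondecrP s : nondecr lt s <-> sorted leO s.
Proof.
elim: s => // a [//|b s] [IH1 IH2]; rewrite [nondecr _ _]/= [sorted _ _]/=.
split=> [[h /IH1 H]|/andP[/asboolP h H]]; last by split=> //; apply: IH2.
by apply/andP; split=> //; apply/asboolP.
Qed.

Lemma exponents_inj s s' : nondecr lt s -> nondecr lt s' -> exponents s = exponents s' -> s = s'.
Proof.
move=> /nondecrP Ss /nondecrP Ss' [E0 E1 E2].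
apply: (sorted_eq leO_trans leO_anti Ss Ss').
rewrite (permPl (perm_of_exponents s)) perm_sym (permPl (perm_of_exponents s')) /of_exponents /=.
have P i : sort leq (part i s) = sort leq (part i s') -> perm_eq (part i s') (part i s).
  by move=> E; rewrite -(perm_sort leq) -E perm_sort.
by rewrite !perm_cat // perm_map // P.
Qed.

Lemma exponents_surj t : srt3 t -> exists s, nondecr lt s /\ exponents s = t.
Proof.
case: t => [[K L] M]; rewrite /srt3 /srt2 /= => /andP[/andP[SK SL] SM].
exists (sort leO (of_exponents (K, L, M))); split.
  by apply/nondecrP; apply: (sort_sorted leO_total).
have P i : sort leq (part i (sort leO (of_exponents (K, L, M)))) = sort leq (part i (of_exponents (K, L, M))).
  apply/perm_sortP; [exact: leq_total|exact: leq_trans|exact: anti_leq|].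
  by rewrite perm_map // perm_filter // perm_sort.
by rewrite /exponents !P !part_of_exponents /= !(sorted_sort leq_trans).
Qed.

Section Monomials.
Variables (F : fieldType) (q : F) (hq0 : q != 0).
Local Notation V := (qshuffle hq0).
Local Notation O := (@oddalt F q hq0).
Local Notation Es := (@evenalt1 F q hq0).

(** Every class number above 1 is read as the class of $W_{k+1}$. *)
Definition Om_elt (i : nat) (k : nat) : V :=
  if i is 0 then O false k else if i is 1 then Es true k else O true k.

Lemma Om_eltE a : ind hq0 (Omega_word a) = Om_elt (Om_cls a) (Om_val a).
Proof. by case: a. Qed.

Lemma Om_elt_comm i k l : Om_elt i k * Om_elt i l = Om_elt i l * Om_elt i k.
Proof. by case: i => [|[|i]]; [apply: O_comm|apply: Es_comm|apply: O_comm]. Qed.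

(** With [r] ranking the classes, a nondecreasing list runs through them by increasing rank: once
    the head has a given class, the tail has no element of lower rank. *)
Lemma prod_class (r : nat -> nat) s :
  (forall a b, (r (Om_cls a) < r (Om_cls b))%N -> lt a b) -> nondecr lt s ->
  forall i j k, (r i < r j)%N -> (r j < r k)%N -> perm_eq [:: i; j; k] [:: 0; 1; 2]%N ->
  \prod_(a <- s) ind hq0 (Omega_word a)
  = pr (Om_elt i) (sort leq (part i s)) * pr (Om_elt j) (sort leq (part j s))
    * pr (Om_elt k) (sort leq (part k s)).
Proof.
move=> Hr /nondecrP Ss i j k ij jk Hp.
rewrite !pr_sort; try exact: Om_elt_comm.
have lec a b : leO a b -> (r (Om_cls a) <= r (Om_cls b))%N.
  case: Hlin => Hi Ht _ /asboolP[ab|-> //]; rewrite leqNgt; apply/negP => /Hr ba.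
  by apply: (Hi a); apply: Ht ba.
have Hc a : Om_cls a \in [:: i; j; k] by rewrite (perm_mem Hp); case: a.
have ijn : i != j by apply: contraTneq ij => ->; rewrite ltnn.
have jkn : j != k by apply: contraTneq jk => ->; rewrite ltnn.
have ikn : i != k by apply: contraTneq (ltn_trans ij jk) => ->; rewrite ltnn.
elim: s Ss => [|a s IH] Ss; first by rewrite big_nil !pr_nil !mulr1.
rewrite big_cons IH ?(path_sorted Ss) //.
have E0 c : (r c < r (Om_cls a))%N -> part c s = [::].
  move=> ca; rewrite /part (_ : [seq _ <- _ | _] = [::]) //.
  apply/eqP; rewrite -[_ == _]negbK -has_filter; apply/hasPn => b bs.
  apply: contraTN ca => /eqP <-; rewrite -leqNgt; apply: lec.
  by move: (order_path_min leO_trans Ss) => /allP; apply.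
have Ep c : part c (a :: s) = if Om_cls a == c then Om_val a :: part c s else part c s.
  by rewrite /part /=; case: eqP.
rewrite Om_eltE !Ep; move: (Hc a); rewrite !inE => /or3P[] /eqP Ea; rewrite Ea in E0 *.
- by rewrite eqxx (negPf ijn) (negPf ikn) pr_cons !mulrA.
- rewrite eqxx (eq_sym j) (negPf ijn) (negPf jkn) (E0 i) // !pr_nil !mul1r.
  by rewrite pr_cons mulrA.
- rewrite eqxx !(eq_sym k) (negPf ikn) (negPf jkn) (E0 i) ?(ltn_trans ij) // (E0 j) //.
  by rewrite !pr_nil !mul1r pr_cons.
Qed.

Lemma pbw_of_basis (e : triple -> V) : basis e ->
  (forall s, nondecr lt s -> \prod_(a <- s) ind hq0 (Omega_word a) = e (exponents s)) ->
  (forall s : seq Omega, nondecr lt s -> inU q (vec (omono q s)))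
  /\
  (forall (ss : seq (seq Omega)) (c : seq Omega -> F),
      uniq ss -> (forall s, s \in ss -> nondecr lt s) ->
      (forall w, \sum_(s <- ss) c s * vec (omono q s) w = 0) ->
      forall s, s \in ss -> c s = 0)
  /\
  (forall f : word -> F, inU q f ->
      exists (ss : seq (seq Omega)) (c : seq Omega -> F),
        (forall s, s \in ss -> nondecr lt s) /\
        f = fun w => \sum_(s <- ss) c s * vec (omono q s) w).
Proof.
move=> [H1 H2 H3] He.
have vecm s : nondecr lt s -> vec (omono q s) = e (exponents s) :> V.
  by move=> Ns; rewrite (vec_omono hq0) He.
split=> [s Ns|]; first by apply/(inU_U hq0); rewrite vecm.
split=> [ss c Uss Pss H s0 s0s|f /(inU_U hq0)/H3 Hf].
  have P i : i \in ss -> c i != 0 -> srt3 (exponents i).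
    by move=> _ _; rewrite /srt3 /srt2 /= !(sort_sorted leq_total).
  have R w : \sum_(s <- ss) c s * e (exponents s) w = 0.
    by rewrite -[RHS](H w); apply: eq_big_seq => s /Pss/vecm ->.
  have := indep_coef H2 P R (exponents s0).
  rewrite big_mkcond (bigD1_seq s0) //= eqxx big1_seq ?addr0 //.
  move=> s /andP[ss0 sss]; case: eqP => // /(exponents_inj (Pss s sss) (Pss s0 s0s)) E.
  by rewrite E eqxx in ss0.
have [ts [Hts Ef]] : exists ts : seq (F * seq Omega),
    (forall t, t \in ts -> nondecr lt t.2) /\
    f = fun w => \sum_(t <- ts) t.1 * vec (omono q t.2) w.
  apply: (Hf (fun f => exists ts : seq (F * seq Omega),
    (forall t, t \in ts -> nondecr lt t.2) /\
    f = fun w => \sum_(t <- ts) t.1 * vec (omono q t.2) w)); first split.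
  - by exists [::]; split=> //; apply/funext => w; rewrite big_nil.
  - move=> c _ _ [ts1 [N1 ->]] [ts2 [N2 ->]].
    exists ([seq (c * t.1, t.2) | t <- ts1] ++ ts2); split=> [t|].
      by rewrite mem_cat => /orP[/mapP[t' /N1 ? ->]|/N2].
    apply/funext => w; rewrite big_cat big_map /= addE scaleE mulr_sumr; congr (_ + _).
    by apply: eq_bigr => t _; rewrite mulrA.
  move=> _ [t [/exponents_surj[s [Ns <-]] ->]]; exists [:: (1, s)]; split=> [t'|].
    by rewrite inE => /eqP ->.
  by apply/funext => w; rewrite big_seq1 mul1r vecm.
exists (undup [seq t.2 | t <- ts]), (fun s => \sum_(t <- ts | t.2 == s) t.1).
split=> [s|]; first by rewrite mem_undup => /mapP[t /Hts ? ->].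
rewrite Ef; apply/funext => w.
under [RHS]eq_bigr => s _ do rewrite big_distrl /=.
rewrite [RHS](exchange_big_dep predT) //= big_seq [RHS]big_seq.
apply: eq_bigr => t tts; under [RHS]eq_bigl => s do rewrite eq_sym.
rewrite (sum_pred1_seq (fun s => t.1 * vec (omono q s) w)) ?undup_uniq //.
by rewrite mem_undup map_f.
Qed.
End Monomials.
End Order.

(* The factors are numbered 0, 1, 2 for W_{-i}, G_{j+1}, W_{k+1}. *)
Definition mono_in_order (F : fieldType) (q : F) (hq0 : q != 0) (i j k : nat) (t : triple) : qshuffle hq0 :=
  let ix n := nth [::] [:: t.1.1; t.1.2; t.2] n in
  pr (Om_elt hq0 i) (ix i) * pr (Om_elt hq0 j) (ix j) * pr (Om_elt hq0 k) (ix k).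

(** * The six orders *)

Section SixOrders.
Variable F : fieldType.

Lemma mono_in_order_inv (q : F) (hq0 : q != 0) (hqV : q^-1 != 0) i j k t :
  inv_rel (mono_in_order hqV i j k t) (mono_in_order hq0 k j i t).
Proof.
have H n (s : seq nat) : inv_rel (pr (Om_elt hqV n) s) (pr (Om_elt hq0 n) s) /\
    exists x, homog false x (pr (Om_elt hq0 n) s).
  have [x Hx] : exists x, forall l, homog false x (Om_elt hq0 n l).
    case: n => [|[|n]]; [exists 1|exists 0|exists (- 1)] => l.
    - exact: homog_O.
    - exact: homog_E.
    - exact: (homog_On (b := false)).
  split; last by exists (x *+ size s); apply: homog_pr.
  have Ef l : Om_elt hqV n l = Om_elt hq0 n l :> (word -> F).
    by case: n {Hx} => [|[|n]].
  by apply: (@inv_pr _ _ _ _ false x) => //; apply: Om_elt_comm.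
rewrite /mono_in_order -mulrA.
have [Hi [x Hx]] := H i (nth [::] [:: t.1.1; t.1.2; t.2] i).
have [Hj [y Hy]] := H j (nth [::] [:: t.1.1; t.1.2; t.2] j).
have [Hk [z Hz]] := H k (nth [::] [:: t.1.1; t.1.2; t.2] k).
apply: (inv_relM Hx (homogM Hz Hy)) => //.
exact: (inv_relM Hy Hz).
Qed.

Lemma basis_mono_inv (q : F) (hq0 : q != 0) (hqV : q^-1 != 0) i j k :
  basis (mono_in_order hqV i j k) -> basis (mono_in_order hq0 k j i).
Proof. by apply: basis_inv => t; apply: mono_in_order_inv. Qed.

Variables (q : F) (hq0 : q != 0).
Hypothesis hq : forall n : nat, (0 < n)%N -> q ^+ n != 1.

Lemma basis_012 : basis (mono_in_order hq0 0 1 2).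
Proof. exact: (basis_BDC hq0 hq false). Qed.

Lemma basis_102 : basis (mono_in_order hq0 1 0 2).
Proof. exact: (basis_DBC hq0 hq false). Qed.

(** For the letter $y$ the order $D B C$ reads $A$, $W_{k+1}$, $W_{-i}$; reversal turns $A$ into $G$
    and gives $W_{-i}$, $W_{k+1}$, $G$. *)
Lemma basis_021 : basis (mono_in_order hq0 0 2 1).
Proof.
have := basis_swap (basis_DBC hq0 hq true).
apply: basis_rv => -[[K L] M]; rewrite /eDBC /eDB /mono_in_order /= !rvM.
rewrite mulrA.
have R n (f : nat -> qshuffle hq0) r : (forall l, rv (f l) = Om_elt hq0 n l) ->
    rv (pr f r) = pr (Om_elt hq0 n) r.
  by move=> Hf; apply: rv_pr => // l l'; apply: Om_elt_comm.
by rewrite (R 0%N (oddalt hq0 false)) ?(R 2%N (oddalt hq0 true)) ?(R 1%N (evenalt1 hq0 false)) // => l; rewrite ?rv_O //; apply: rv_E.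
Qed.
End SixOrders.

Theorem theorem10p2 (F : fieldType) (q : F)
  (hq0 : q != 0) (hq : forall n : nat, (0 < n)%N -> q ^+ n != 1)
  (lt : Omega -> Omega -> Prop)
  (Hlin : strict_linear_order lt) (Hcases : order_cases lt) :
  (* the PBW monomials lie in Ualg *)
  (forall s : seq Omega, nondecr lt s -> inU q (vec (omono q s)))
  /\
  (* they are linearly independent *)
  (forall (ss : seq (seq Omega)) (c : seq Omega -> F),
      uniq ss -> (forall s, s \in ss -> nondecr lt s) ->
      (forall w, \sum_(s <- ss) c s * vec (omono q s) w = 0) ->
      forall s, s \in ss -> c s = 0)
  /\
  (* they span Ualg *)
  (forall f : word -> F, inU q f ->
      exists (ss : seq (seq Omega)) (c : seq Omega -> F),
        (forall s, s \in ss -> nondecr lt s) /\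
        f = fun w => \sum_(s <- ss) c s * vec (omono q s) w).
Proof.
have hqV : q^-1 != 0 by rewrite invr_neq0.
have hV := not_root_inv hq.
have Ht : forall a b c, lt a b -> lt b c -> lt a c by case: Hlin.
suff [e [He Hs]] : exists e : triple -> qshuffle hq0, basis e /\
    forall s, nondecr lt s -> \prod_(a <- s) ind hq0 (Omega_word a) = e (exponents s).
  exact: (pbw_of_basis Hlin He Hs).
have main i j k : basis (mono_in_order hq0 i j k) ->
    perm_eq [:: i; j; k] [:: 0; 1; 2]%N ->
    (forall a b, Om_cls a = i -> Om_cls b = j -> lt a b) ->
    (forall a b, Om_cls a = j -> Om_cls b = k -> lt a b) ->
    exists e : triple -> qshuffle hq0, basis e /\
    forall s, nondecr lt s -> \prod_(a <- s) ind hq0 (Omega_word a) = e (exponents s).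
  move=> Hb Hp Hij Hjk; exists (mono_in_order hq0 i j k); split=> // s Ns.
  have Hu : uniq [:: i; j; k] by rewrite (perm_uniq Hp).
  move: (Hu); rewrite /= !inE negb_or !andbT => /andP[/andP[ij ik] jk].
  have Hc a : Om_cls a \in [:: i; j; k] by rewrite (perm_mem Hp); case: a.
  (* Only neighbouring classes are compared by hypothesis; an element of the middle class links the
     outer two by transitivity. *)
  have [m Hm] : exists m, Om_cls m = j.
    have : j \in [:: 0; 1; 2]%N by rewrite -(perm_mem Hp) !inE eqxx orbT.
    by rewrite !inE => /or3P[] /eqP ->; [exists (Om_Wm 0)|exists (Om_G 0)|exists (Om_Wp 0)].
  have Hr a b : (index (Om_cls a) [:: i; j; k] < index (Om_cls b) [:: i; j; k])%N -> lt a b.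
    move: (Hc a) (Hc b); rewrite !inE.
    move=> /or3P[] /eqP Ea /or3P[] /eqP Eb;
      rewrite Ea Eb /= ?eqxx ?(negPf ij) ?(negPf ik) ?(negPf jk)
        ?(eq_sym j i) ?(eq_sym k i) ?(eq_sym k j) ?(negPf ij) ?(negPf ik) ?(negPf jk) //= => _.
    - exact: Hij.
    - by apply: (Ht _ m); [apply: Hij|apply: Hjk].
    - exact: Hjk.
  have := @prod_class _ Hlin _ _ hq0 (fun n => index n [:: i; j; k]) s Hr Ns i j k.
  rewrite /= ?eqxx ?(negPf ij) ?(negPf ik) ?(negPf jk) => -> //.
  rewrite /mono_in_order /exponents /=.
  have P n : n \in [:: 0; 1; 2]%N -> nth [::] [:: sort leq (part 0 s);
      sort leq (part 1 s); sort leq (part 2 s)] n = sort leq (part n s).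
    by rewrite !inE => /or3P[] /eqP ->.
  by rewrite !P // -(perm_mem Hp) !inE eqxx ?orbT.
(* Orders (ii), (iii), (v) are the reverses of (i), (vi), (iv) and come from those for $1/q$. The
   index 0 fills the quantifier not involved in a comparison. *)
case: Hcases => [H|[H|[H|[H|[H|H]]]]].
- apply: (main 0 1 2)%N => //; first exact: basis_012.
    by case=> i [] j //= _ _; case: (H i j 0%N).
  by case=> i [] j //= _ _; case: (H 0%N i j).
- apply: (main 2 1 0)%N => //; first exact: basis_mono_inv (basis_012 hqV hV).
    by case=> i [] j //= _ _; case: (H 0%N j i).
  by case=> i [] j //= _ _; case: (H j i 0%N).
- apply: (main 2 0 1)%N => //; first exact: basis_mono_inv (basis_102 hqV hV).
    by case=> i [] j //= _ _; case: (H j 0%N i).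
  by case=> i [] j //= _ _; case: (H i j 0%N).
- apply: (main 0 2 1)%N => //; first exact: basis_021.
    by case=> i [] j //= _ _; case: (H i 0%N j).
  by case=> i [] j //= _ _; case: (H 0%N j i).
- apply: (main 1 2 0)%N => //; first exact: basis_mono_inv (basis_021 hqV hV).
    by case=> i [] j //= _ _; case: (H 0%N i j).
  by case=> i [] j //= _ _; case: (H j 0%N i).
- apply: (main 1 0 2)%N => //; first exact: basis_102.
    by case=> i [] j //= _ _; case: (H j i 0%N).
  by case=> i [] j //= _ _; case: (H i 0%N j).
Qed.
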